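(* Let $\mathcal{X} \subset \mathbb{C}$ be a compact set with $\mathrm{cap}(\mathcal{X}) > 0$. Then there is a function $\varepsilon_{\mathcal{X}} : \mathbb{N} \to \mathbb{R}$, depending only on $\mathcal{X}$, with $\varepsilon_{\mathcal{X}}(l) \to 0$ as $l \to \infty$, such that the following holds. Let $n, k \geq 1$ be integers, let $A \in \mathbb{C}^{n \times n}$ be diagonalizable with $VAV^{-1} = D$ for an invertible $V$ and a diagonal $D$, and suppose all eigenvalues of $A$ lie in $\mathcal{X}$. Let $B \in \mathbb{C}^{n \times k}$ and $t_{\min} := \lceil n/k \rceil - 1$. Then \[ \lambda_{\min}\big(W(t_{\min})\big) \leq \mathrm{cond}^2(V)\, \|B\|_F^2 \, \Big( \big(1 + \varepsilon_{\mathcal{X}}(t_{\min})\big)\, \mathrm{cap}^2(\mathcal{X}) \Big)^{t_{\min}}. \]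
   Context: For $A \in \mathbb{C}^{n\times n}$, $B \in \mathbb{C}^{n \times k}$ and an integer $t \ge 0$, the $t$-step controllability Gramian is $W(t) := \sum_{i=0}^{t} A^i B B^* (A^* )^i$, where $^*$ denotes conjugate transpose; $\lambda_{\min}$ denotes the smallest eigenvalue of this positive semidefinite Hermitian matrix. $\mathrm{cond}(V) := \|V\|_2 \|V^{-1}\|_2$ (spectral norms), and $\|B\|_F$ is the Frobenius norm. For a compact set $K \subset \mathbb{C}$, let $I(K) := \sup_{\mu} \int_{K\times K} \log|z-w|\, d\mu(z)\, d\mu(w)$, the supremum over Borel probability measures $\mu$ supported on $K$; the logarithmic capacity is $\mathrm{cap}(K) := e^{I(K)}$. *)

(* Defs.v *)
From HB Require Import structures.
From mathcomp Require Import all_boot all_order all_algebra.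
From mathcomp Require Import all_classical all_reals all_analysis.
From mathcomp.real_closed Require Import complex.
Set Implicit Arguments. Unset Strict Implicit. Unset Printing Implicit Defensive.
Import Order.TTheory GRing.Theory Num.Theory.
Import numFieldNormedType.Exports.
Local Open Scope classical_set_scope.
Local Open Scope ring_scope.

(* Complex numbers are R[i] (mathcomp-real-closed) for R : realType.
   For measure-theoretic purposes a complex number z is identified with the
   point (Re z, Im z) of the plane R * R (product of Borel sigma-algebras,
   which is the Borel sigma-algebra of C). *)

Section Defs.
Context {R : realType}.
Local Notation C := (complex R).

Definition c2p (z : C) : R * R := (complex.Re z, complex.Im z).

Definition cabs (z : C) : R :=
  Num.sqrt (complex.Re z ^+ 2 + complex.Im z ^+ 2).

Definition ctr m n (M : 'M[C]_(m, n)) : 'M[C]_(n, m) := map_mx (@conjc R) M^T.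

Definition gramian n k (A : 'M[C]_n) (B : 'M[C]_(n, k)) (t : nat) : 'M[C]_n :=
  \sum_(i < t.+1) (A ^+ i *m B *m ctr B *m (ctr A) ^+ i).

(* smallest eigenvalue of a (Hermitian) matrix: infimum of its real
   eigenvalues (all eigenvalues of a Hermitian matrix are real) *)
Definition lambda_min n (W : 'M[C]_n) : R :=
  inf [set r : R | eigenvalue W (r%:C)%C].

Definition vnorm n (x : 'cV[C]_n) : R :=
  Num.sqrt (\sum_(i < n) cabs (x i ord0) ^+ 2).

Definition specnorm m n (M : 'M[C]_(m, n)) : R :=
  sup [set vnorm (M *m x) | x in [set x : 'cV[C]_n | vnorm x = 1]].

Definition cond n (V : 'M[C]_n) : R := specnorm V * specnorm (invmx V).

Definition frob m n (M : 'M[C]_(m, n)) : R :=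
  Num.sqrt (\sum_(i < m) \sum_(j < n) cabs (M i j) ^+ 2).

Definition logdist (zw : (R * R) * (R * R)) : \bar R :=
  let d := Num.sqrt ((zw.1.1 - zw.2.1) ^+ 2 + (zw.1.2 - zw.2.2) ^+ 2) in
  if d == 0 then -oo%E else (ln d)%:E.

Definition log_energy_sup (K : set C) : \bar R :=
  ereal_sup [set (\int[(mu \x mu)%E]_zw logdist zw)%E
            | mu in [set mu : probability (R * R)%type R |
                      mu (~` (c2p @` K)) = 0%E]].

Definition cap (K : set C) : \bar R := expeR (log_energy_sup K).

End Defs.

(* Main.v *)
(** The Gramian is K K^*, K = [B, AB, .., A^t B], and the first t blocks have
    rank at most tk < n, so some row x <> 0 kills B, .., A^(t-1) B.  Then
    x W(t) x^* = |x A^t B|^2 = |x p(A) B|^2 for every monic p of degree t, which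
    diagonalization bounds by |x|^2 cond(V)^2 |B|_F^2 max_X |p|^2.

    It remains to find monic polynomials with max_X |p|^(1/t) asymptotically at
    most cap X.  If instead, for some c > cap X and arbitrarily large t, every
    monic p of degree t exceeded c^t on X, then near-maximal (Fekete)
    configurations of t+1 points of X would satisfy
    prod_{j <> k} |z_k - z_j| >= c^t / 2 for each k.  Listing the points in a
    suitable order turns each configuration into a step function ]0,1[ -> X;
    a subsequence converges almost everywhere, and by Fatou the image of the
    uniform law under the limit has logarithmic energy at least ln c,
    contradicting c > cap X. *)
Require Import Defs.
From HB Require Import structures.
From mathcomp Require Import all_boot all_order all_algebra.
From mathcomp Require Import all_classical all_reals all_analysis.
From mathcomp.real_closed Require Import complex.
From mathcomp Require Import measurable_realfun ring lra.
Import Order.TTheory GRing.Theory Num.Theory.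
Import numFieldNormedType.Exports.
Set Implicit Arguments. Unset Strict Implicit. Unset Printing Implicit Defensive.
Local Open Scope classical_set_scope.
Local Open Scope ring_scope.

(** * Matrix norms and the Gramian *)

Section MatrixNorms.
Context {R : realType}.
Local Notation C := (complex R).

Lemma cabsE (z : C) : cabs z = complex.ComplexField.Normc.normc z.
Proof. by case: z. Qed.

Lemma cabs_ge0 (z : C) : 0 <= cabs z.
Proof. exact: sqrtr_ge0. Qed.

Lemma cabsM (x y : C) : cabs (x * y) = cabs x * cabs y.
Proof. by rewrite !cabsE complex.ComplexField.Normc.normcM. Qed.

Lemma cabs0 : cabs (0 : C) = 0.
Proof. by rewrite cabsE complex.ComplexField.Normc.normc0. Qed.

Lemma le_cabsD (x y : C) : cabs (x + y) <= cabs x + cabs y.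
Proof. by rewrite !cabsE; exact: le_normcD. Qed.

Lemma cabs_sum (I : finType) (F : I -> C) :
  cabs (\sum_i F i) <= \sum_i cabs (F i).
Proof.
elim/big_ind2 : _ => [|x a y b xa yb|//]; first by rewrite cabs0.
by rewrite (le_trans (le_cabsD _ _)) ?lerD.
Qed.

Lemma mulJ_cabs (z : C) : z * conjc z = (cabs z ^+ 2)%:C%C.
Proof.
rewrite -sqr_normc normc_def -/(cabs z) -rmorphXn //.
Qed.

Lemma frobE m n (M : 'M[C]_(m, n)) :
  frob M ^+ 2 = \sum_i \sum_j cabs (M i j) ^+ 2.
Proof.
by rewrite sqr_sqrtr // !sumr_ge0 // => i _; rewrite sumr_ge0 // => j _; rewrite sqr_ge0.
Qed.

Lemma frob_ge0 m n (M : 'M[C]_(m, n)) : 0 <= frob M.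
Proof. exact: sqrtr_ge0. Qed.

Lemma vnormE n (x : 'cV[C]_n) : vnorm x = frob x.
Proof. by rewrite /vnorm /frob; congr Num.sqrt; apply: eq_bigr => i _; rewrite big_ord1. Qed.

Lemma frob_eq0 m n (M : 'M[C]_(m, n)) : frob M = 0 -> M = 0.
Proof.
move=> M0; have := frobE M; rewrite M0 expr0n/= => /esym/eqP.
rewrite psumr_eq0 => [/allP H|i _]; last by rewrite sumr_ge0 // => j _; rewrite sqr_ge0.
apply/matrixP => i j; rewrite mxE.
have := H i (mem_index_enum _); rewrite psumr_eq0 => [/allP/(_ j (mem_index_enum _))|k _].
  rewrite expf_eq0/= cabsE => /eqP/complex.ComplexField.Normc.eq0_normc //.
by rewrite sqr_ge0.
Qed.

Lemma frobZ m n (a : C) (M : 'M[C]_(m, n)) : frob (a *: M) = cabs a * frob M.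
Proof.
apply/eqP; rewrite -(@eqrXn2 _ 2) ?mulr_ge0 ?cabs_ge0 ?frob_ge0 //.
rewrite exprMn !frobE mulr_sumr; apply/eqP/eq_bigr => i _.
by rewrite mulr_sumr; apply: eq_bigr => j _; rewrite mxE cabsM exprMn.
Qed.

Lemma frob_sqr m n (M : 'M[C]_(m, n)) : \tr (M *m ctr M) = (frob M ^+ 2)%:C%C.
Proof.
rewrite frobE /mxtrace rmorph_sum; apply: eq_bigr => i _.
rewrite mxE rmorph_sum; apply: eq_bigr => j _.
by rewrite !mxE mulJ_cabs.
Qed.

(** Lagrange's identity: the double sum of (a_i b_j - a_j b_i)^2 is twice the gap between the two
    sides. *)
Lemma sum_mulr_CauchySchwarz (I : finType) (a b : I -> R) :
  (\sum_i a i * b i) ^+ 2 <= (\sum_i a i ^+ 2) * (\sum_i b i ^+ 2).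
Proof.
have : 0 <= \sum_i \sum_j (a i * b j - a j * b i) ^+ 2.
  by rewrite sumr_ge0 // => i _; rewrite sumr_ge0 // => j _; rewrite sqr_ge0.
have -> : \sum_i \sum_j (a i * b j - a j * b i) ^+ 2 =
  ((\sum_i a i ^+ 2) * (\sum_i b i ^+ 2) - (\sum_i a i * b i) ^+ 2) *+ 2.
  have S1 : \sum_i \sum_j a i ^+ 2 * b j ^+ 2 = (\sum_i a i ^+ 2) * (\sum_i b i ^+ 2).
    by rewrite mulr_suml; apply: eq_bigr => i _; rewrite mulr_sumr.
  have P1 : \sum_i \sum_j (a i * b i) * (a j * b j) = (\sum_i a i * b i) ^+ 2.
    by rewrite expr2 mulr_suml; apply: eq_bigr => i _; rewrite mulr_sumr.
  rewrite -S1 -P1 -sumrB -sumrMnl.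
  have -> : \sum_i \sum_j (a i * b j - a j * b i) ^+ 2 =
     \sum_i \sum_j (a i ^+ 2 * b j ^+ 2 - (a i * b i) * (a j * b j)) +
     \sum_i \sum_j (a j ^+ 2 * b i ^+ 2 - (a j * b j) * (a i * b i)).
    rewrite -big_split/=; apply: eq_bigr => i _.
    by rewrite -big_split/=; apply: eq_bigr => j _; ring.
  rewrite [X in _ + X]exchange_big/= -mulr2n -sumrMnl.
  by apply: eq_bigr => i _; rewrite sumrB.
by rewrite pmulrn_lge0 // subr_ge0.
Qed.

(** Cauchy-Schwarz in each entry, a row of [M] against a column of [N]. *)
Lemma frob_mulmx m n p (M : 'M[C]_(m, n)) (N : 'M[C]_(n, p)) :
  frob (M *m N) <= frob M * frob N.
Proof.
rewrite -(@ler_pXn2r _ 2) ?nnegrE ?mulr_ge0 ?frob_ge0 // exprMn !frobE.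
rewrite [X in _ * X]exchange_big/= mulr_suml; apply: ler_sum => i _.
rewrite mulr_sumr; apply: ler_sum => j _; rewrite mxE.
apply: le_trans (sum_mulr_CauchySchwarz _ _).
rewrite ler_pXn2r ?nnegrE ?cabs_ge0 ?sumr_ge0 // => [|k _]; last by rewrite mulr_ge0 ?cabs_ge0.
by apply: le_trans (cabs_sum _) _; apply: ler_sum => k _; rewrite cabsM.
Qed.

Lemma frob_col m n (M : 'M[C]_(m, n)) :
  frob M ^+ 2 = \sum_j frob (col j M) ^+ 2.
Proof.
rewrite frobE exchange_big/=; apply: eq_bigr => j _; rewrite frobE.
by apply: eq_bigr => i _; rewrite big_ord1 mxE.
Qed.

(** A nonzero [x] is rescaled to a unit vector. The crude bound [frob_mulmx] shows that the set
    under [sup] is bounded, so that [sup] is a true supremum. *)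
Lemma vnorm_mulmx m n (M : 'M[C]_(m, n)) (x : 'cV[C]_n) :
  frob (M *m x) <= specnorm M * frob x.
Proof.
have [x0|x0] := eqVneq (frob x) 0.
  by rewrite (le_trans (frob_mulmx _ _)) // x0 !mulr0.
have fx : 0 < frob x by rewrite lt_def x0 frob_ge0.
rewrite -ler_pdivrMr // mulrC.
set a := ((frob x)^-1)%:C%C.
have ca : cabs a = (frob x)^-1.
  by rewrite /cabs /= expr0n addr0 sqrtr_sqr ger0_norm // invr_ge0 ltW.
rewrite -ca -frobZ scalemxAr.
apply: ub_le_sup; last first.
  exists (a *: x); last by rewrite vnormE.
  by rewrite /= vnormE frobZ ca mulVf // gt_eqF.
exists (frob M) => _ [y /= y1 <-]; rewrite vnormE; apply: (le_trans (frob_mulmx _ _)).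
by rewrite -vnormE y1 mulr1.
Qed.

Lemma specnorm_ge0 m n (M : 'M[C]_(m, n)) : 0 <= specnorm M.
Proof.
rewrite /specnorm; set S := (X in sup X).
(* Without columns there is no unit vector, and [sup] of the empty set is 0. *)
have [->|/set0P[_ [x /= x1 _]]] := eqVneq S set0; first by rewrite sup0.
apply: (le_trans (frob_ge0 (M *m x))).
by rewrite (le_trans (vnorm_mulmx _ _)) // -vnormE x1 mulr1.
Qed.

(** Applied column by column. This mixed bound lets [V] enter through spectral norms although [B] is
    measured in the Frobenius norm. *)
Lemma frob_specnorm m n p (M : 'M[C]_(m, n)) (N : 'M[C]_(n, p)) :
  frob (M *m N) <= specnorm M * frob N.
Proof.
rewrite -(@ler_pXn2r _ 2) ?nnegrE ?mulr_ge0 ?frob_ge0 ?specnorm_ge0 //.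
rewrite exprMn !frob_col mulr_sumr; apply: ler_sum => j _.
rewrite -exprMn ler_pXn2r ?nnegrE ?mulr_ge0 ?frob_ge0 ?specnorm_ge0 //.
by rewrite colE -mulmxA -colE vnorm_mulmx.
Qed.

Lemma frob_diag n p (d : 'rV[C]_n) (N : 'M[C]_(n, p)) (c : R) : 0 <= c ->
  (forall i, cabs (d 0 i) <= c) -> frob (diag_mx d *m N) <= c * frob N.
Proof.
move=> c0 dc; rewrite -(@ler_pXn2r _ 2) ?nnegrE ?mulr_ge0 ?frob_ge0 //.
rewrite exprMn !frobE mulr_sumr; apply: ler_sum => i _.
rewrite mulr_sumr; apply: ler_sum => j _; rewrite mul_diag_mx mxE cabsM -exprMn.
by rewrite ler_pXn2r ?nnegrE ?mulr_ge0 ?cabs_ge0 // ler_wpM2r ?cabs_ge0.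
Qed.

(** * Quadratic form and smallest eigenvalue of the Gramian *)

Lemma ctrM m n p (M : 'M[C]_(m, n)) (N : 'M[C]_(n, p)) :
  ctr (M *m N) = ctr N *m ctr M.
Proof. by rewrite /ctr trmx_mul map_mxM. Qed.

Lemma ctrK m n (M : 'M[C]_(m, n)) : ctr (ctr M) = M.
Proof. by apply/matrixP => i j; rewrite !mxE conjcK. Qed.

Lemma ctrX n (M : 'M[C]_n) i : ctr (M ^+ i) = ctr M ^+ i.
Proof.
elim: i => [|i IH]; last by rewrite exprS exprSr ctrM IH.
by rewrite /ctr !expr0 trmx1 map_mx1.
Qed.

Lemma gramian_herm n k (A : 'M[C]_n) (B : 'M[C]_(n, k)) t :
  ctr (gramian A B t) = gramian A B t.
Proof.
rewrite /gramian {1}/ctr linear_sum raddf_sum /=.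
apply: eq_bigr => i _.
by rewrite -/(ctr _) !ctrM -ctrX !ctrK ctrX !mulmxA.
Qed.

Lemma gramian_form n k (A : 'M[C]_n) (B : 'M[C]_(n, k)) t (x : 'rV[C]_n) :
  \tr (x *m gramian A B t *m ctr x) =
  (\sum_(i < t.+1) frob (x *m A ^+ i *m B) ^+ 2)%:C%C.
Proof.
rewrite /gramian mulmx_sumr mulmx_suml raddf_sum rmorph_sum /=.
by apply: eq_bigr => i _; rewrite -frob_sqr !ctrM ctrX !mulmxA.
Qed.

(** Rayleigh's principle. By the spectral theorem W = P^* diag(d) P with P unitary, and the form at
    x is the sum of d_i |y_i|^2 with y = x P^*. Positive semidefiniteness supplies the lower bound
    that the infimum in [lambda_min] requires. *)
Lemma lambda_min_le n (W : 'M[C]_n) (x : 'rV[C]_n) (q : R) :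
  ctr W = W -> (forall y : 'rV[C]_n, 0 <= \tr (y *m W *m ctr y)) ->
  \tr (x *m W *m ctr x) = q%:C%C -> lambda_min W * frob x ^+ 2 <= q.
Proof.
move=> hW psd xq.
have nW : W \is normalmx.
  apply/normalmxP; suff -> : map_mx Num.conj W^T = W by [].
  have -> : map_mx Num.conj W^T = ctr W by apply/matrixP => i j; rewrite !mxE.
  by rewrite -[RHS]hW.
have /orthomx_spectralP EW := nW.
set P := spectralmx W in EW; set d := spectral_diag W in EW.
have uP : P *m ctr P = 1%:M by have /unitarymxP := spectral_unitarymx W.
have uP' : ctr P *m P = 1%:M by rewrite mulmx1C.
have iP : invmx P = ctr P.
  by rewrite -[LHS]mulmx1 -uP mulKmx // spectral_unit.
rewrite iP in EW.
have lb r : eigenvalue W r%:C%C -> 0 <= r.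
  case/eigenvalueP => v Wv v0; have := psd v.
  rewrite Wv -scalemxAl mxtraceZ frob_sqr -rmorphM ler0c pmulr_lge0 // exprn_gt0 //.
  by rewrite lt_def frob_ge0 andbT; apply: contra_neq v0; exact: frob_eq0.
(* Eigenvectors are rows for [eigenvalue], so row i of [P] serves. *)
have ev i : eigenvalue W (d 0 i).
  apply/eigenvalueP; exists (row i P).
    rewrite {1}EW !mulmxA -row_mul uP row1 -!rowE.
    by apply/rowP => j; rewrite row_diag_mx -scalemxAl -rowE.
  apply/eqP => P0; have := congr1 (row i) uP.
  rewrite row_mul P0 mul0mx row1 => /rowP/(_ i); rewrite !mxE !eqxx => /eqP.
  by rewrite eq_sym oner_eq0.
have dr i : d 0 i = (complex.Re (d 0 i))%:C%C.
  rewrite -[LHS]RRe_real //.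
  have /mxOverP/(_ 0 i) : d \is a realmx.
    apply: hermitian_spectral_diag_real; apply/is_hermitianmxP.
    by rewrite scale1r -[LHS]hW.
  by [].
pose y := x *m ctr P.
have -> : frob x ^+ 2 = frob y ^+ 2.
  apply: (@complexI R); rewrite -!frob_sqr /y ctrM ctrK mulmxA.
  by rewrite -(mulmxA x) uP' mulmx1.
suff -> : q = \sum_i complex.Re (d 0 i) * cabs (y 0 i) ^+ 2.
  rewrite frobE big_ord1 mulr_sumr; apply: ler_sum => i _.
  rewrite ler_wpM2r ?sqr_ge0 //; apply: ge_inf; first by exists 0 => r /= /lb.
  by rewrite /= -dr.
apply: (@complexI R); rewrite -xq EW !mulmxA -[_ *m P *m _]mulmxA -/y.
have -> : P *m ctr x = ctr y by rewrite ctrM ctrK.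
rewrite mul_mx_diag /mxtrace big_ord1 mxE rmorph_sum; apply: eq_bigr => i _.
rewrite !mxE mulrAC mulJ_cabs mulrC [in RHS]rmorphM; congr (_ * _); exact: dr.
Qed.

(** The block row [B, AB, .., A^(t-1) B] has only t k columns, so its left kernel is nonzero. *)
Lemma krylov_kernel n k (A : 'M[C]_n) (B : 'M[C]_(n, k)) t : (t * k < n)%N ->
  exists2 v : 'rV[C]_n, v != 0 & forall i, (i < t)%N -> v *m A ^+ i *m B = 0.
Proof.
move=> tk; pose M := \mxrow_(j < t) (A ^+ j *m B).
have /rowV0Pn[v /sub_kermxP vM v0] : kermx M != 0.
  rewrite -mxrank_eq0 mxrank_ker subn_eq0 -ltnNge.
  by rewrite (leq_ltn_trans (rank_leq_col M)) // sum_nat_const card_ord.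
exists v => // i it; move: vM; rewrite mul_mxrow => /(congr1 (fun K => submxrow K
  (Ordinal it))).
by rewrite mxrowK submxrow0 mulmxA.
Qed.

(** [lambda_min_le] is tested on a Krylov kernel row v: only the last summand of the form survives,
    and there A^t can be exchanged for p(A), which V conjugates to p(D). The index floor((n - 1)/k)
    equals ceil(n/k) - 1 and is the largest t with t k < n. *)
Lemma lambda_min_gramian_le n k (A V D : 'M[C]_n) (B : 'M[C]_(n, k))
    (p : {poly C}) (c : R) (t := (n.-1 %/ k)%N) :
  (0 < n)%N -> (0 < k)%N -> V \in unitmx -> is_diag_mx D ->
  V *m A *m invmx V = D -> p \is monic -> size p = t.+1 -> 0 <= c ->
  (forall a, eigenvalue A a -> cabs p.[a] <= c) ->
  lambda_min (gramian A B t) <= cond V ^+ 2 * frob B ^+ 2 * c ^+ 2.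
Proof.
move=> + k0 uV /is_diag_mxP Dd VAV pm sp c0 hp.
case: n => // n in A V D B t uV Dd VAV sp hp *; move=> _.
have [v v0 vB] : exists2 v : 'rV[C]_n.+1, v != 0 &
    forall i, (i < t)%N -> v *m A ^+ i *m B = 0.
  by apply: krylov_kernel; rewrite ltnS leq_divM.
have fv : 0 < frob v.
  by rewrite lt_def frob_ge0 andbT; apply: contra_neq v0; exact: frob_eq0.
pose d := \row_i D i i.
have Ed : D = diag_mx d.
  apply/matrixP => i j; rewrite !mxE; have [->|ij] := eqVneq i j; first by rewrite mulr1n.
  by rewrite mulr0n Dd.
have VA : V *m A = D *m V by rewrite -VAV mulmxKV.
have ev i : eigenvalue A (d 0 i).
  apply/eigenvalueP; exists (row i V).
    rewrite -row_mul VA Ed row_mul row_diag_mx -scalemxAl -rowE //.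
  apply/eqP => V0; have := congr1 (row i) (mulmxV uV).
  rewrite row_mul V0 mul0mx row1 => /rowP/(_ i); rewrite !mxE !eqxx => /eqP.
  by rewrite eq_sym oner_eq0.
have EA : A = invmx V *m D *m V by rewrite -mulmxA -VA mulKmx.
(* Since p is monic of degree t and v kills the lower powers, v A^t B = v p(A) B. *)
have hA : v *m A ^+ t *m B = v *m (invmx V *m (diag_mx (map_mx (horner p) d) *m (V *m B))).
  have <- : horner_mx A p *m B = invmx V *m (diag_mx (map_mx (horner p) d) *m (V *m B)).
    by rewrite EA Ed horner_mx_uconjC // horner_mx_diag !mulmxA.
  rewrite -[p]coefK poly_def raddf_sum /= sp mulmxA mulmx_sumr mulmx_suml big_ord_recr /=.
  rewrite big1 ?add0r => [|i _].
    by rewrite linearZ rmorphXn /= horner_mx_X -scalemxAr -scalemxAl (_ : p`_t = 1)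
      ?scale1r // -(monicP pm) lead_coefE sp.
  by rewrite linearZ rmorphXn /= horner_mx_X -scalemxAr -scalemxAl vB // scaler0.
have := @lambda_min_le _ (gramian A B t) v _ (gramian_herm _ _ _) _ (gramian_form _ _ _ _).
rewrite big_ord_recr /= big1 ?add0r => [/(_ _)/le_trans H|i _]; last first.
  by rewrite vB // frobE big1 // => a _; rewrite big1 // => b _; rewrite mxE cabs0 expr0n.
rewrite -(ler_pM2r (_ : 0 < frob v ^+ 2)) ?exprn_gt0 //; apply: H.
  by move=> y; rewrite gramian_form ler0c sumr_ge0 // => i _; rewrite sqr_ge0.
rewrite hA -!exprMn ler_pXn2r ?nnegrE ?mulr_ge0 ?frob_ge0 ?specnorm_ge0 //.
apply: (le_trans (frob_mulmx _ _)); rewrite mulrC ler_wpM2r ?frob_ge0 //.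
apply: (le_trans (frob_specnorm _ _)); rewrite /cond [specnorm V * _]mulrC -!mulrA.
rewrite ler_wpM2l ?specnorm_ge0 //.
apply: (le_trans (frob_diag (V *m B) c0 _)) => [i|]; first by rewrite mxE hp.
rewrite mulrC mulrA ler_wpM2r // frob_specnorm //.
Qed.
End MatrixNorms.

(** * Fekete points *)

Section Fekete.
Context {R : realType}.
Local Notation C := (complex R).

Lemma cabs_prod (I : Type) (r : seq I) (P : pred I) (F : I -> C) :
  cabs (\prod_(i <- r | P i) F i) = \prod_(i <- r | P i) cabs (F i).
Proof.
apply: (big_morph _ (@cabsM R)).
by rewrite cabsE complex.ComplexField.Normc.normc1.
Qed.

Lemma cabsB (x y : C) : cabs (x - y) = cabs (y - x).
Proof. by rewrite !cabsE -normcN opprB. Qed.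

Lemma cabs_gt0 (x : C) : (0 < cabs x) = (x != 0).
Proof.
rewrite lt_def cabs_ge0 andbT; congr (~~ _); apply/eqP/eqP => [|->].
  by rewrite cabsE => /complex.ComplexField.Normc.eq0_normc.
exact: cabs0.
Qed.

Lemma ln_prod (I : Type) (r : seq I) (P : pred I) (F : I -> R) :
  (forall i, P i -> 0 < F i) ->
  ln (\prod_(i <- r | P i) F i) = \sum_(i <- r | P i) ln (F i).
Proof.
move=> F0; suff [] : 0 < \prod_(i <- r | P i) F i /\
  ln (\prod_(i <- r | P i) F i) = \sum_(i <- r | P i) ln (F i) by [].
elim/big_ind2 : _ => [|x a y b [x0 xa] [y0 yb]|i Pi]; first by rewrite ln1.
  by rewrite mulr_gt0 // lnM ?posrE // xa yb.
by rewrite F0.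
Qed.

(* Every pair of indices contributes twice: this is the square of the Vandermonde
   product. *)
Definition pair_prod m (z : 'I_m -> C) : R :=
  \prod_i \prod_(j | j != i) cabs (z i - z j).

Lemma pair_prodE m (z : 'I_m -> C) k :
  pair_prod z = (\prod_(j | j != k) cabs (z k - z j)) ^+ 2 *
    \prod_(i | i != k) \prod_(j | (j != i) && (j != k)) cabs (z i - z j).
Proof.
rewrite /pair_prod (bigD1 k) //= expr2 -mulrA; congr (_ * _).
rewrite -big_split /=; apply: eq_bigr => i ik.
by rewrite (bigD1 k) 1?eq_sym //= cabsB.
Qed.

(** Exchange argument: the monic polynomial whose roots are the other t points exceeds c^t at some w
    in X, and putting w in place of z_k can hardly increase [pair_prod]. *)
Lemma exists_fekete (X : set C) (L c : R) (t : nat) : 0 < c ->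
  (forall x y, X x -> X y -> cabs (x - y) <= L) ->
  (forall p : {poly C}, p \is monic -> size p = t.+1 ->
     exists2 z, X z & c ^+ t < cabs p.[z]) ->
  exists z : 'I_t.+1 -> C, [/\ injective z, forall i, X (z i) &
    forall k, c ^+ t / 2 <= \prod_(j | j != k) cabs (z k - z j)].
Proof.
move=> c0 XL Xp.
have ct0 : 0 < c ^+ t by rewrite exprn_gt0.
(* X has t + 1 distinct points: if s has at most t of them, the polynomial with roots s, padded by
   roots at 0 to degree t, is nonzero at some point of X, which thus lies outside s. This makes the
   supremum below positive. *)
have [z0 z0i z0X] : exists2 z : 'I_t.+1 -> C, injective z & forall i, X (z i).
  have : forall i, (i <= t.+1)%N ->
      exists s : seq C, [/\ uniq s, size s = i & forall a, a \in s -> X a].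
    elim=> [_|i IH it]; first by exists [::].
    have [s [us ss sX]] := IH (ltnW it).
    have [||z Xz pz] := Xp (\prod_(a <- s ++ nseq (t - i) 0) ('X - a%:P)).
    - exact: monic_prod_XsubC.
    - by rewrite size_prod_XsubC size_cat ss size_nseq subnKC.
    exists (z :: s); split => /=; last 1 first.
    - by move=> a; rewrite inE => /predU1P[->//|]; exact: sX.
    - rewrite us andbT; apply/negP => zs; move: pz; rewrite ltNge => /negP; apply.
      rewrite (_ : _.[z] = 0) ?cabs0 ?ltW //; apply/rootP.
      by rewrite root_prod_XsubC mem_cat zs.
    - by rewrite ss.
  move=> /(_ _ (leqnn _))[s [us ss sX]]; exists (fun i => s`_i).
    by move=> i j /eqP; rewrite nth_uniq ?ss // => /eqP/val_inj.
  by move=> i; apply/sX/mem_nth; rewrite ss.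
pose S := [set pair_prod z | z in [set z : 'I_t.+1 -> C | forall i, X (z i)]].
have S0 : pair_prod z0 > 0.
  apply: prodr_gt0 => i _; apply: prodr_gt0 => j ji.
  by rewrite cabs_gt0 subr_eq0 eq_sym (inj_eq z0i).
have Sb : has_sup S.
  split; first by exists (pair_prod z0), z0.
  exists (\prod_(i < t.+1) \prod_(j < t.+1 | j != i) L) => _ [z Xz <-].
  apply: ler_prod => i _; rewrite prodr_ge0 => [|j _]; last exact: cabs_ge0.
  by apply: ler_prod => j _; rewrite cabs_ge0 XL.
have sup0 : 0 < sup S.
  by apply: (lt_le_trans S0); apply: ub_le_sup; [case: Sb|exists z0].
(* A configuration within a factor 4 of the supremum is enough: replacing z_k
   multiplies the product by the square of one ratio, whence the loss of 2. *)
have e0 : 0 < sup S * (3 / 4) by rewrite mulr_gt0 // divr_gt0.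
have [_ [z Xz <-] Gz] := sup_adherent e0 Sb.
have {}Gz : sup S / 4 < pair_prod z by apply: le_lt_trans Gz; lra.
have Gz0 : 0 < pair_prod z by apply: lt_trans Gz; rewrite divr_gt0.
exists z; split => //.
  move=> i j zij; apply/eqP/negPn/negP => ij; move: Gz0.
  rewrite /pair_prod (bigD1 i) //= (bigD1 j) 1?eq_sym //= zij subrr cabs0.
  by rewrite !mul0r ltxx.
move=> k; have [|w Xw pw] := Xp (\prod_(a <- [seq z j | j <- rem k (enum 'I_t.+1)]) ('X -
  a%:P)) (monic_prod_XsubC _ _ _).
  by rewrite size_prod_XsubC size_map size_rem ?mem_enum // size_enum_ord.
pose z' i := if i == k then w else z i.
have Gz' : pair_prod z' <= sup S.
  apply: ub_le_sup; first by case: Sb.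
  by exists z' => // i; rewrite /z'; case: ifP.
move: Gz Gz0; rewrite (pair_prodE z k).
set P := \prod_(j | j != k) _; set Q := \prod_(i | i != k) _ => Gz Gz0.
have P0 : 0 <= P by apply: prodr_ge0 => *; exact: cabs_ge0.
have Q0 : 0 < Q.
  rewrite lt_def prodr_ge0 => [|i _]; last by apply: prodr_ge0 => *; exact: cabs_ge0.
  by rewrite andbT; apply/eqP => Q0; move: Gz0; rewrite Q0 mulr0 ltxx.
move: Gz'; rewrite (pair_prodE z' k).
have -> : \prod_(i | i != k) \prod_(j | (j != i) && (j != k)) cabs (z' i - z' j) = Q.
  apply: eq_bigr => i ik; apply: eq_bigr => j /andP[_ jk].
  by rewrite /z' (negbTE ik) (negbTE jk).
have -> : \prod_(j | j != k) cabs (z' k - z' j) = cabs (\prod_(a <- [seq z j | j <- rem k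
  (enum 'I_t.+1)]) ('X - a%:P)).[w].
  rewrite horner_prod cabs_prod big_map.
  rewrite rem_filter ?enum_uniq // big_filter big_enum_cond.
  by apply: eq_bigr => j jk; rewrite /z' eqxx (negbTE jk) hornerXsubC.
set U := cabs _ in pw * => GU.
(* From U^2 Q <= sup S and sup S / 4 < P^2 Q, after cancelling Q. *)
have : U ^+ 2 / 4 < P ^+ 2.
  rewrite -(ltr_pM2r Q0); apply: le_lt_trans Gz; rewrite mulrAC ler_pM2r //.
have -> : U ^+ 2 / 4 = (U / 2) ^+ 2 by field.
rewrite ltr_pXn2r ?nnegrE ?divr_ge0 ?cabs_ge0 // => UP.
by rewrite ltW // (le_lt_trans _ UP) // ler_pM2r // ltW.
Qed.

(** Logarithm of the previous bound, summed over the t + 1 points. Lists replace families because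
    the points will be reordered. *)
Lemma exists_fekete_seq (X : set C) (L c : R) (t : nat) : 0 < c ->
  (forall x y, X x -> X y -> cabs (x - y) <= L) ->
  (forall p : {poly C}, p \is monic -> size p = t.+1 ->
     exists2 z, X z & c ^+ t < cabs p.[z]) ->
  exists s : seq C, [/\ uniq s, size s = t.+1, forall a, a \in s -> X a &
    t.+1%:R * (t%:R * ln c - ln 2) <=
      \sum_(x <- s) \sum_(y <- s | y != x) ln (cabs (x - y))].
Proof.
move=> c0 XL Xp; have [z [zi zX zP]] := exists_fekete c0 XL Xp.
exists [seq z i | i <- enum 'I_t.+1]; split.
- by rewrite map_inj_uniq // enum_uniq.
- by rewrite size_map size_enum_ord.
- by move=> _ /mapP[i _ ->].
rewrite big_map big_enum.
rewrite -[t.+1 in leLHS]card_ord -sum1_card natr_sum mulr_suml; apply: ler_sum => k _.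
rewrite mul1r big_map big_enum_cond (eq_bigl (fun j => j != k)); last by move=> j;
  rewrite (inj_eq zi).
have Pk := zP k; rewrite -ln_prod; last first.
  by move=> j jk; rewrite cabs_gt0 subr_eq0 eq_sym (inj_eq zi).
have ct0 : 0 < c ^+ t by rewrite exprn_gt0.
apply: le_trans (_ : ln (c ^+ t / 2) <= _).
  by rewrite lnM ?posrE ?invr_gt0 // lnXn // lnV ?posrE // mulr_natl.
by rewrite ler_ln // posrE ?divr_gt0 // (lt_le_trans _ Pk) // divr_gt0.
Qed.
End Fekete.

(** * Almost everywhere convergent step functions *)

(** The entries below a form an initial segment of a sorted list. *)
Lemma nth_sorted_ltn (s : seq nat) (a i : nat) : sorted leq s -> (i < size s)%N ->
  (nth 0%N s i < a)%N = (i < count (ltn^~ a) s)%N.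
Proof.
elim: s i => // x s IH i xs; have ss := path_sorted xs.
have [xa|ax] := ltnP x a; first by case: i => [|i] /=; rewrite xa // add1n ltnS => /IH ->.
have le_as y : y \in x :: s -> (a <= y)%N.
  rewrite inE => /predU1P[->//|ys]; apply: (leq_trans ax).
  by have /allP := order_path_min leq_trans xs; exact.
move=> ix; rewrite ltnNge le_as ?mem_nth //=; apply/esym/negbTE.
have : ~~ has (ltn^~ a) (x :: s).
  by apply/hasP => -[y /le_as]; rewrite leqNgt => /negbTE /= ->.
by rewrite has_count -eqn0Ngt => /eqP /= ->.
Qed.

Section Codes.
Context {R : realType}.

(** Tychonoff gives a cluster point l in a product of unit intervals. The k-th index is taken beyond
    k, with all coordinates in the first k by k block within 1/(k+1) of l. [sigma] need not
    increase: later arguments use only [k <= sigma k]. *)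
Lemma diagonal_extraction (x : nat -> nat * nat -> R) :
  (forall k p, 0 <= x k p <= 1) ->
  exists (sigma : nat -> nat) (l : nat * nat -> R),
    (forall k, (k <= sigma k)%N) /\ forall p, x (sigma k) p @[k --> \oo] --> l p.
Proof.
move=> x01.
pose T := prod_topology (fun _ : nat * nat => R).
have : compact [set f : T | forall p, f p \in `[0%R, 1%R]].
  by apply: (@tychonoff _ (fun=> R) (fun=> [set` `[0%R, 1%R]])) => p; exact: segment_compact.
move=> /(_ (x @ \oo) _)[|l [_ xl]].
  by exists 0%N => // k _ p; rewrite in_itv; exact: x01.
have /choice[sigma sP] : forall k, exists i, (k <= i)%N /\
    forall p : 'I_k * 'I_k, `|l (val p.1, val p.2) - x i (val p.1, val p.2)| < k.+1%:R^-1.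
  move=> k; have [||f [[i /= ki <-] fl]] := xl
     (x @` [set i | (k <= i)%N])
     [set f | forall p : 'I_k * 'I_k, `|l (val p.1, val p.2) - f (val p.1, val p.2)| <
       k.+1%:R^-1].
  - by exists k => // i /= ki; exists i.
  - apply: (@filter_forall T _ (fun p : 'I_k * 'I_k =>
        [set f : T | `|l (val p.1, val p.2) - f (val p.1, val p.2)| < k.+1%:R^-1]) (nbhs
          l)) => p.
    have pc := @proj_continuous (nat * nat)%type (fun _ => R : topologicalType) (val p.1,
      val p.2) l.
    apply: (pc (ball (l (val p.1, val p.2)) k.+1%:R^-1)).
    by apply: nbhsx_ballx; rewrite invr_gt0.
  - by exists i.
exists sigma, l; split => [k|[j a]]; first by have [] := sP k.
apply/cvgrPdist_lt => e e0; near=> k.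
have jk : (j < k)%N by near: k; exists j.+1.
have ak : (a < k)%N by near: k; exists a.+1.
have [_ /(_ (Ordinal jk, Ordinal ak)) /= H] := sP k.
apply: (lt_trans H); near: k; exact: near_infty_natSinv_lt (PosNum e0).
Unshelve. all: by end_near. Qed.

(* Mixed-radix numbers whose j-th pair of digits are the coordinates rounded to
   mesh 1/j, so that sorting by c j also sorts by every coarser c i. *)
Lemma codes (M : R) : exists (c : nat -> R * R -> nat) (B : nat -> nat),
  [/\ forall j z, `|z.1| <= M -> `|z.2| <= M -> (c j z < B j)%N,
      forall i j z w, `|z.2| <= M -> `|w.2| <= M -> `|z.1| <= M -> `|w.1| <= M ->
        (i <= j)%N -> (c j z <= c j w)%N -> (c i z <= c i w)%N &
      forall e, 0 < e -> exists j, forall z w,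
        `|z.1| <= M -> `|z.2| <= M -> `|w.1| <= M -> `|w.2| <= M ->
        c j z = c j w -> `|z.1 - w.1| < e /\ `|z.2 - w.2| < e].
Proof.
pose a j (x : R) := Num.truncn ((x + M) * j%:R).
pose N j := (Num.truncn ((M + M) * j%:R)).+1.
have aN j x : `|x| <= M -> (a j x < N j)%N.
  rewrite ler_norml => /andP[_ xM]; rewrite /N ltnS; apply: le_truncn.
  by rewrite ler_wpM2r // lerD2r.
pose c := fix c j (z : R * R) := if j is j'.+1 then ((c j' z * N j + a j z.1) * N j + a j
  z.2)%N else 0%N.
pose B := fix B j := if j is j'.+1 then (B j' * N j * N j)%N else 1%N.
(* Dividing by the radix strips the last digit, so two divisions lead back one level. *)
have div j z : `|z.2| <= M -> (c j.+1 z %/ N j.+1 = c j z * N j.+1 + a j.+1 z.1)%N.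
  by move=> z2; rewrite /= divnMDl // divn_small ?addn0 ?aN.
have div2 j z : `|z.2| <= M -> `|z.1| <= M -> (c j z = c j.+1 z %/ N j.+1 %/ N j.+1)%N.
  by move=> z2 z1; rewrite div // divnMDl // divn_small ?addn0 ?aN.
exists c, B; split.
- move=> j z z1 z2; elim: j => [//|j IH].
  rewrite -ltn_divLR // -ltn_divLR // -div2 //.
- move=> i j z w z2 w2 z1 w1; elim: j => [|j IH]; first by rewrite leqn0 => /eqP->.
  rewrite leq_eqVlt ltnS => /predU1P[->//|/IH ij] cc; apply: ij.
  by rewrite (div2 j z) // (div2 j w) // !leq_div2r.
- move=> e e0.
  (* Level j = n + 1 has mesh 1/j < e. Equal codes have equal last two digits, hence both
     coordinates agree up to the mesh. *)
  have [n _ /(_ n (leqnn n)) ej] := near_infty_natSinv_lt (PosNum e0).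
  pose j := n.+1; have j0 : 0 < j%:R :> R := ltr0Sn R n.
  rewrite -/j /= in ej.
  have close x y : `|x| <= M -> `|y| <= M -> a j x = a j y -> `|x - y| < e.
    rewrite !ler_norml => /andP[x1 _] /andP[y1 _] axy.
    have /truncn_itv : 0 <= (x + M) * j%:R by rewrite mulr_ge0 // -lerBlDr sub0r.
    have /truncn_itv : 0 <= (y + M) * j%:R by rewrite mulr_ge0 // -lerBlDr sub0r.
    rewrite -/(a j x) -/(a j y) axy -natr1 => /andP[y2 y3] /andP[x2 x3].
    apply: le_lt_trans ej; rewrite -[leLHS](mulfK (lt0r_neq0 j0)) ler_pdivrMr // mulVf
      ?gt_eqF //.
    rewrite -[j%:R in leLHS]ger0_norm // -normrM ler_norml.
    by apply/andP; split; nra.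
  exists j => z w z1 z2 w1 w2 cc.
  have cc1 := congr1 (divn^~ (N j)) cc; rewrite !div // -/j in cc1.
  have cc2 := congr1 (modn^~ (N j)) cc; rewrite /= !modnMDl !modn_small ?aN // in cc2.
  have cc3 := congr1 (modn^~ (N j)) cc1; rewrite !modnMDl !modn_small ?aN // in cc3.
  by split; apply: close.
Qed.

(** For nonempty s, each entry is taken on an interval of length 1/(size s) in [0,1[, so the uniform
    law is carried to the normalised counting measure; [z0] appears only for u >= 1. *)
Definition step_fun (z0 : R * R) (s : seq (R * R)) (u : R) : R * R :=
  nth z0 s (Num.truncn ((size s)%:R * u)).

Lemma cauchy_eventually_close (y : nat -> R) :
  (forall e, 0 < e -> exists K, forall i j, (K <= i)%N -> (K <= j)%N -> `|y i - y j| < e) ->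
  cvgn y.
Proof.
move=> yP; apply: cauchy_cvg; apply: cauchy_exP => e e0.
have [K yK] := yP e e0; exists (y K); exists K => // i /= Ki.
by rewrite /= -ball_normE; exact: yK.
Qed.

(* After sorting, the points of each cell have consecutive indices; the rescaled
   ends of these blocks converge along sigma, and for u outside the set E of
   their limits the cell of step_fun u is eventually constant at each level. *)
Lemma step_fun_cvg (z0 : R * R) (M : R) (s : nat -> seq (R * R)) :
  (forall k z, z \in s k -> `|z.1| <= M /\ `|z.2| <= M) ->
  (forall k, (k < size (s k))%N) ->
  exists (s' : nat -> seq (R * R)) (sigma : nat -> nat) (E : set R),
    [/\ forall k, (k <= sigma k)%N, forall k, perm_eq (s' k) (s (sigma k)),
      countable E &
      forall u, 0 < u < 1 -> ~ E u ->
        cvgn (fun k => (step_fun z0 (s' k) u).1) /\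
        cvgn (fun k => (step_fun z0 (s' k) u).2)].
Proof.
move=> sM ssize; have [c [B [cB cmono cclose]]] := codes M.
(* The k-th list is sorted at its own level k, hence by [cmono] at every level j <= k. *)
pose s0 k := sort (relpre (c k) leq) (s k).
have ps0 k : perm_eq (s0 k) (s k) by rewrite perm_sort.
have s0M k z : z \in s0 k -> `|z.1| <= M /\ `|z.2| <= M.
  by rewrite (perm_mem (ps0 k)); exact: sM.
have ss0 k : (0 < size (s0 k))%N by rewrite (perm_size (ps0 k)) (leq_ltn_trans _ (ssize k)).
pose cnt k (p : nat * nat) : nat := count (fun z => c p.1 z < p.2)%N (s0 k).
pose x k p : R := (cnt k p)%:R / (size (s0 k))%:R.
have [|sigma [l [ksigma xl]]] := diagonal_extraction (x := x).
  move=> k p; rewrite divr_ge0 //= ler_pdivrMr ?ltr0n // mul1r ler_nat.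
  exact: count_size.
exists (s0 \o sigma), sigma, (range l); split => //.
- by move=> k; exact: ps0.
- exact: (sub_countable (card_image_le l setT)) (countableP _).
move=> u /andP[u0 u1] Eu.
have aP : forall j, exists a, exists K, forall k, (K <= k)%N ->
    [/\ c j (step_fun z0 (s0 (sigma k)) u) = a & step_fun z0 (s0 (sigma k)) u \in s0 (sigma k)].
  move=> j.
  (* No code is below 0 and all are below [B j], so the limits of the block ends start at 0 and
     finish at 1, enclosing u. *)
  have lj0 : l (j, 0%N) = 0.
    rewrite -(cvg_lim (@Rhausdorff R) (xl (j, 0%N))).
    apply: (cvg_lim (@Rhausdorff R)); apply: cvg_near_cst; near=> k.
    by rewrite /x /cnt (@eq_count _ _ pred0) ?count_pred0 ?mul0r.
  have ljB : l (j, B j) = 1.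
    rewrite -(cvg_lim (@Rhausdorff R) (xl (j, B j))).
    apply: (cvg_lim (@Rhausdorff R)); apply: cvg_near_cst; near=> k.
    rewrite /x /cnt (@eq_in_count _ _ predT) ?count_predT ?divff ?pnatr_eq0 -?lt0n //.
    by move=> z /s0M[z1 z2] /=; rewrite cB.
  (* The least limit end beyond u has index [a.+1]. Since u is none of the limits, it lies strictly
     inside that block, hence also inside the actual block for large k. *)
  pose Q a := u < l (j, a).
  have [|a Qa amin] := @ex_minnP Q; first by exists (B j); rewrite /Q ljB.
  case: a Qa amin => [|a]; first by rewrite /Q lj0 ltNge (ltW u0).
  rewrite /Q => ua amin.
  have au : l (j, a) < u.
    rewrite lt_neqAle leNgt; apply/andP; split.
      by apply/eqP => lu; apply: Eu; exists (j, a).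
    by apply/negP => /amin; rewrite ltnn.
  exists a.
  have [K1 _ H1] := cvgr_lt _ (xl (j, a)) _ au.
  have [K2 _ H2] := cvgr_gt _ (xl (j, a.+1)) _ ua.
  exists (maxn j (maxn K1 K2)) => k; rewrite !geq_max => /and3P[jk /H1 /= x1 /H2 /= x2].
  set t := s0 (sigma k); have t0 : (0 < size t)%N by exact: ss0.
  have tR : 0 < (size t)%:R :> R by rewrite ltr0n.
  move: x1 x2; rewrite /x -/t ltr_pdivrMr // ltr_pdivlMr //.
  rewrite [u * _]mulrC /step_fun => x1 x2.
  have nu0 : 0 <= (size t)%:R * u by rewrite mulr_ge0 // ltW.
  set i := Num.truncn _.
  have it : (i < size t)%N by rewrite truncn_lt_nat // -[ltRHS]mulr1 ltr_pM2l.
  have ti : nth z0 t i \in t by rewrite mem_nth.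
  have st : sorted leq (map (c j) t).
    rewrite sorted_map; apply: (@sub_in_sorted _ (mem t) (relpre (c (sigma k)) leq)).
    - move=> z w zt wt /=; have [z1 z2] := s0M _ _ zt; have [w1 w2] := s0M _ _ wt.
      by apply: cmono => //; exact: leq_trans jk (ksigma k).
    - exact/allP.
    - by apply: sort_sorted => z w; exact: leq_total.
  (* Turns a bound on the code into a bound on the index i = floor(size * u), which the position of
     u decides. *)
  have key b : (c j (nth z0 t i) < b)%N = (i < cnt (sigma k) (j, b))%N.
    have := @nth_sorted_ltn _ b i st; rewrite size_map => /(_ it).
    by rewrite (nth_map z0) // count_map.
  split => //; apply/eqP; rewrite eqn_leq; apply/andP; split.
    rewrite -ltnS key truncn_lt_nat //.
  rewrite leqNgt key -leqNgt truncn_ge_nat //; exact: ltW.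
have close e : 0 < e -> exists K, forall i j, (K <= i)%N -> (K <= j)%N ->
    `|(step_fun z0 (s0 (sigma i)) u).1 - (step_fun z0 (s0 (sigma j)) u).1| < e /\
    `|(step_fun z0 (s0 (sigma i)) u).2 - (step_fun z0 (s0 (sigma j)) u).2| < e.
  move=> e0; have [j cj] := cclose e e0; have [a [K KP]] := aP j.
  exists K => k1 k2 /KP[c1 /s0M[? ?]] /KP[c2 /s0M[? ?]].
  by apply: cj => //; rewrite c1 c2.
split; apply: cauchy_eventually_close => e /close[K KP]; exists K => i j Ki Kj.
- by have [] := KP i j Ki Kj.
- by have [] := KP i j Ki Kj.
Unshelve. all: by end_near. Qed.
End Codes.

(** * Logarithmic energy of the limit *)

Section UniformLaw.
Context {R : realType}.
Local Open Scope ereal_scope.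

Definition unif : probability (measurableTypeR R) R := uniform_prob (@ltr01 R).

Lemma unif_null (A : set R) : measurable A -> lebesgue_measure A = 0 -> unif A = 0.
Proof.
move=> mA A0; have := @dominates_uniform_prob R 0%R 1%R ltr01.
by move=> /null_content_dominatesP; apply.
Qed.

Lemma unif_lebesgue (A : set R) : measurable A -> A `<=` `[0%R, 1%R]%classic ->
  unif A = lebesgue_measure A.
Proof.
move=> mA A01; rewrite /unif /= /uniform_prob integral_uniform_pdf setIidl //.
rewrite (eq_integral (fun=> 1)); first by rewrite integral_cst // mul1e.
move=> u; rewrite inE => /A01 /=; rewrite in_itv /= => u01.
by rewrite /uniform_pdf u01 subr0 invr1.
Qed.

Lemma unif_setC01 : unif (~` `]0%R, 1%R[%classic) = 0.
Proof.
rewrite probability_setC // unif_lebesgue //; last exact: subset_itv_oo_cc.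
by rewrite lebesgue_measure_itv /= lte01 oppr0 adde0 subee.
Qed.

Definition edist (z w : R * R) : R :=
  Num.sqrt ((z.1 - w.1) ^+ 2 + (z.2 - w.2) ^+ 2).

Lemma logdistE z w : logdist (z, w) =
  if edist z w == 0%R then -oo else (ln (edist z w))%:E.
Proof. by []. Qed.

Lemma edist_ge0 z w : (0 <= edist z w)%R.
Proof. exact: sqrtr_ge0. Qed.

Lemma edist_eq0 z w : (edist z w == 0%R) = (z == w).
Proof.
case: z w => a b [c d]; rewrite sqrtr_eq0 /= le_eqVlt ltNge addr_ge0 ?sqr_ge0 // orbF.
by rewrite paddr_eq0 ?sqr_ge0 // !sqrf_eq0 !subr_eq0.
Qed.

Lemma logdist_lt z w (B : R) : (logdist (z, w) < B%:E) = (edist z w < expR B)%R.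
Proof.
rewrite logdistE; case: eqVneq => [->|d0]; first by rewrite ltNyr expR_gt0.
by rewrite lte_fin -{2}[edist z w]lnK ?ltr_expR // posrE lt_def d0 edist_ge0.
Qed.

Lemma measurable_edist : measurable_fun setT (fun zw : (R * R) * (R * R) => edist zw.1 zw.2).
Proof.
have msqrt : measurable_fun [set: R] (@Num.sqrt R).
  by apply: continuous_measurable_fun; exact: sqrt_continuous.
apply: (measurableT_comp msqrt).
apply: measurable_funD; apply: measurable_funX; apply: measurable_funB.
- exact: measurableT_comp measurable_fst measurable_fst.
- exact: measurableT_comp measurable_fst measurable_snd.
- exact: measurableT_comp measurable_snd measurable_fst.
- exact: measurableT_comp measurable_snd measurable_snd.
Qed.

Lemma measurable_logdist : measurable_fun setT (@logdist R).
Proof.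
apply: measurable_fun_ifT => //.
  by apply: measurable_fun_eqr => //; exact: measurable_edist.
apply/measurable_EFinP; apply: measurableT_comp; first exact: measurable_ln.
exact: measurable_edist.
Qed.

(** Any f is allowed: the preimage is a countable union of level sets of [truncn], each built from
    half-lines. *)
Lemma measurable_truncn d (U : measurableType d) (f : nat -> U) (m : R) :
  measurable_fun [set: measurableTypeR R] (fun u : R => f (Num.truncn (m * u)%R)).
Proof.
apply: (measurableT_comp (f := fun u : R => f (Num.truncn u)) (g := fun u : R => m *
  u)%R); last first.
  exact: mulrl_measurable.
move=> _ Y mY; rewrite setTI.
rewrite (_ : _ @^-1` _ = \bigcup_(n in f @^-1` Y) (fun u : R => Num.truncn u) @^-1` [set
  n]); last first.
  apply/seteqP; split => [u /= Yu|u [n /= Yn un]]; last by rewrite /preimage /= un.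
  by exists (Num.truncn u).
apply: bigcup_measurable => n _.
have mge k : measurable [set u : R | (k < Num.truncn u)%N].
  rewrite (_ : [set u | _] = [set` `[k.+1%:R, +oo[%R]) //.
  by apply/seteqP; split => u /=; rewrite in_itv /= andbT truncn_gt_nat.
case: n => [|n].
  rewrite (_ : _ @^-1` _ = ~` [set u : R | (0 < Num.truncn u)%N]); first exact: measurableC.
  by apply/seteqP; split => u /=; [move=> ->|case: Num.truncn].
rewrite (_ : _ @^-1` _ = [set u : R | (n < Num.truncn u)%N] `\` [set u : R | (n.+1 <
  Num.truncn u)%N]); first exact: measurableD.
apply/seteqP; split => u /=; first by move=> ->; split; rewrite ?ltnn.
move=> [nu /negP]; rewrite -leqNgt => un; apply/eqP; rewrite eqn_leq un; exact: nu.
Qed.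

End UniformLaw.

(** * Integrals of step functions as finite sums *)

Section StepIntegral.
Context {R : realType}.
Local Open Scope ereal_scope.

Lemma measurable_step_fun d (U : measurableType d) (f : R * R -> U) z0 s :
  measurable_fun [set: measurableTypeR R] (fun u : R => f (step_fun z0 s u)).
Proof. exact: (measurable_truncn (fun i => f (nth z0 s i))). Qed.

Lemma integral_step_fun (z0 : R * R) (s : seq (R * R)) (f : R * R -> R) :
  (0 < size s)%N -> (forall z, 0 <= f z)%R ->
  \int[unif]_u (f (step_fun z0 s u))%:E =
  ((size s)%:R^-1 * \sum_(z <- s) f z)%:E.
Proof.
move=> s0 f0; set N := size s.
have N0 : (0 < N%:R :> R)%R by rewrite ltr0n.
have mf : measurable_fun [set: measurableTypeR R] (fun u => (f (step_fun z0 s u))%:E).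
  by apply/measurable_EFinP; exact: measurable_step_fun.
rewrite integral_uniform // => [|u]; last by rewrite lee_fin.
(* The endpoint 1 is dropped: the index there would be N, past the end of s. *)
rewrite subr0 invr1 mul1e -integral_itv_bndo_bndc; last exact: measurable_funTS.
pose I (i : 'I_N) : set R := `[(i%:R / N%:R)%R, (i.+1%:R / N%:R)%R[%classic.
transitivity (\int[lebesgue_measure]_(u in `[0%R, 1%R[)
    (\sum_(i < N) (f (nth z0 s i))%:E * (\1_(I i) u)%:E)).
  apply: eq_integral.
  move=> u; rewrite inE /= in_itv /= => /andP[u0 u1].
  have Nu0 : (0 <= N%:R * u)%R by rewrite mulr_ge0 // ltW.
  rewrite /step_fun -/N; set k := Num.truncn _.
  have kN : (k < N)%N by rewrite truncn_lt_nat // -[ltRHS]mulr1 ltr_pM2l.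
  have IE (i : 'I_N) : (\1_(I i) u = (i == Ordinal kN)%:R :> R)%R.
    rewrite indicE; congr (_%:R); congr (nat_of_bool _).
    rewrite mem_setE /I in_itv /= ler_pdivrMr // ltr_pdivlMr // [(u * _)%R]mulrC.
    by rewrite -truncn_eq // eq_sym.
  rewrite (bigD1 (Ordinal kN)) //= IE eqxx mule1 big1 ?adde0 // => i ik.
  by rewrite IE (negbTE ik) mule0.
rewrite ge0_integral_sum //; last 2 first.
- move=> i; apply/measurable_EFinP; apply: measurable_funM => //.
  by apply: measurable_indic; exact: measurable_itv.
- by move=> i u _; rewrite -EFinM lee_fin mulr_ge0.
transitivity (\sum_(i < N) ((f (nth z0 s i))%:E * (N%:R^-1)%:E)).
  apply: eq_bigr => i _; rewrite ge0_integralZl_EFin //; last first.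
    by apply/measurable_EFinP; apply: measurable_indic; exact: measurable_itv.
  congr (_ * _); rewrite integral_indic //; last exact: measurable_itv.
  rewrite setIidl.
    rewrite /= lebesgue_measure_itv /= lte_fin ltr_pM2r ?invr_gt0 // ltr_nat ltnSn -EFinB.
    by rewrite -mulrBl -natrB // subSnn mul1r.
  move=> u; rewrite /I /= !in_itv /= => /andP[iu ui]; apply/andP; split.
    by rewrite (le_trans _ iu) // divr_ge0.
  by rewrite (lt_le_trans ui) // ler_pdivrMr // mul1r ler_nat.
rewrite -ge0_sume_distrl; last by move=> i _; rewrite lee_fin.
rewrite sumEFin -EFinM mulrC; congr (_ * _)%:E%E.
by rewrite (big_nth z0) big_mkord.
Qed.

(** Tonelli and the one-variable formula twice. This turns a double integral into a discrete
    energy. *)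
Lemma integral2_step_fun (z0 : R * R) (s : seq (R * R)) (f : R * R -> R * R -> R) :
  (0 < size s)%N -> (forall z w, 0 <= f z w)%R ->
  measurable_fun [set: (R * R) * (R * R)] (fun zw => f zw.1 zw.2) ->
  \int[unif \x unif]_uv (f (step_fun z0 s uv.1) (step_fun z0 s uv.2))%:E =
  ((size s)%:R^-1 ^+ 2 * \sum_(z <- s) \sum_(w <- s) f z w)%:E.
Proof.
move=> s0 f0 mf.
rewrite (@fubini_tonelli1 _ _ _ _ _ unif unif (fun uv => (f (step_fun z0 s uv.1)
  (step_fun z0 s uv.2))%:E)); last 2 first.
- apply/measurable_EFinP.
  apply: (measurableT_comp mf (g := fun uv => (step_fun z0 s uv.1, step_fun z0 s uv.2))).
  apply: measurable_fun_pair.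
    exact: (measurableT_comp (@measurable_step_fun _ _ id z0 s) measurable_fst).
  exact: (measurableT_comp (@measurable_step_fun _ _ id z0 s) measurable_snd).
- by move=> uv; rewrite lee_fin.
rewrite /fubini_F /=.
under eq_integral do rewrite integral_step_fun //.
rewrite (@integral_step_fun z0 s (fun z => (size s)%:R^-1 * \sum_(w <- s) f z w)%R) //.
  by rewrite -mulr_sumr mulrA.
by move=> z; rewrite mulr_ge0 ?invr_ge0 // sumr_ge0.
Qed.
End StepIntegral.

(** * Image laws and semicontinuity of the logarithmic kernel *)

Section EnergyLimit.
Context {R : realType}.
Local Open Scope ereal_scope.

(** The product of the image laws is the image of P x P under g x g, since both agree on
    rectangles. *)
Lemma integral_distribution_prod d (T : measurableType d) (P : probability T R)
    d' (U : measurableType d') (g : {mfun T >-> U}) (f : U * U -> \bar R) :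
  measurable_fun setT f ->
  (P \x P).-integrable setT (fun uv => f (g uv.1, g uv.2)) ->
  \int[distribution P g \x distribution P g]_zw f zw =
  \int[P \x P]_uv f (g uv.1, g uv.2).
Proof.
move=> mf fi.
have mG : measurable_fun setT (fun uv : T * T => (g uv.1, g uv.2)).
  apply: measurable_fun_pair.
    exact: (measurableT_comp (measurable_funPT g) measurable_fst).
  exact: (measurableT_comp (measurable_funPT g) measurable_snd).
pose G : {mfun (T * T)%type >-> (U * U)%type} := mfun_Sub (mem_set mG).
rewrite (eq_measure_integral (pushforward (P \x P) G)).
  by rewrite integral_pushforward.
move=> A mA _; apply: product_measure_unique => // B C mB mC.
rewrite /pushforward /= -[RHS]/(P (g @^-1` B) * P (g @^-1` C)) -product_measure1E //.
  by rewrite -[X in measurable X]setTI; exact: measurable_funPT.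
by rewrite -[X in measurable X]setTI; exact: measurable_funPT.
Qed.

(** Real thresholds suffice, also for x = +oo, the value of L - [logdist] where two limit points
    coincide. *)
Lemma le_limn_einf (x : \bar R) (u : nat -> \bar R) :
  (forall a : R, a%:E < x -> exists K, forall k, (K <= k)%N -> a%:E <= u k) ->
  x <= limn_einf u.
Proof.
move=> xu.
have au (a : R) : a%:E < x -> a%:E <= limn_einf u.
  move=> /xu[K uK]; rewrite limn_einf_lim; apply: lime_ge; first exact: is_cvg_einfs.
  near=> n; apply: le_ereal_inf_tmp => _ [k /= nk <-]; apply: uK.
  by apply: leq_trans nk; near: n; exists K.
rewrite leNgt; apply/negP; move: (limn_einf u) x au {xu} => y x au yx.
have [a [ax ya]] : exists a : R, a%:E < x /\ y < a%:E.
  case: x y yx {au} => [x| |] [y| |] // yx.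
  - by exists ((x + y) / 2)%R; move: yx; rewrite !lte_fin => yx; split; lra.
  - by exists (x - 1)%R; rewrite ltNyr lte_fin; split => //; lra.
  - by exists (y + 1)%R; rewrite ltry lte_fin; split => //; lra.
  - by exists 0%R; rewrite ltry ltNyr.
by have := au _ ax; rewrite leNgt ya.
Unshelve. all: by end_near. Qed.

Lemma edist_cvg (z w : nat -> R * R) (z' w' : R * R) :
  (z k).1 @[k --> \oo] --> z'.1 -> (z k).2 @[k --> \oo] --> z'.2 ->
  (w k).1 @[k --> \oo] --> w'.1 -> (w k).2 @[k --> \oo] --> w'.2 ->
  edist (z k) (w k) @[k --> \oo] --> edist z' w'.
Proof.
move=> z1 z2 w1 w2.
apply: (@cvg_comp _ _ _ (fun k => ((z k).1 - (w k).1) ^+ 2 + ((z k).2 - (w k).2) ^+ 2)%R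
  (@Num.sqrt R)); last first.
  exact: sqrt_continuous.
by apply: cvgD; rewrite expr2; under eq_fun do rewrite expr2; apply: cvgM; apply: cvgB.
Qed.

(** Upper semicontinuity also covers coinciding limits, where [logdist] is -oo; through [logdist_lt]
    it reduces to continuity of [edist]. *)
Lemma logdist_usc (z w : nat -> R * R) (z' w' : R * R) (B : R) :
  (z k).1 @[k --> \oo] --> z'.1 -> (z k).2 @[k --> \oo] --> z'.2 ->
  (w k).1 @[k --> \oo] --> w'.1 -> (w k).2 @[k --> \oo] --> w'.2 ->
  logdist (z', w') < B%:E ->
  exists K, forall k, (K <= k)%N -> logdist (z k, w k) < B%:E.
Proof.
move=> z1 z2 w1 w2; rewrite logdist_lt => dB.
have [K _ HK] := cvgr_lt _ (edist_cvg z1 z2 w1 w2) _ dB.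
by exists K => k /HK; rewrite logdist_lt.
Qed.

(* The kernel L - logdist without its infinite diagonal. *)
Definition pos_logdist (L : R) (z w : R * R) : R :=
  if edist z w == 0%R then 0%R else Num.max 0%R (L - ln (edist z w))%R.

Lemma pos_logdist_ge0 L z w : (0 <= pos_logdist L z w)%R.
Proof. by rewrite /pos_logdist; case: ifP => // _; rewrite le_max lexx. Qed.

Lemma measurable_pos_logdist L :
  measurable_fun [set: (R * R) * (R * R)] (fun zw => pos_logdist L zw.1 zw.2).
Proof.
apply: measurable_fun_ifT => //.
  by apply: measurable_fun_eqr => //; exact: measurable_edist.
apply: measurable_maxr => //; apply: measurable_funB => //.
by apply: measurableT_comp; [exact: measurable_ln|exact: measurable_edist].
Qed.
End EnergyLimit.

(** * Energy of the limit law *)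

Section EnergyBound.
Context {R : realType}.
Local Open Scope ereal_scope.
(* Keeps unification from unfolding the Lebesgue measure. *)
Local Opaque unif.

Lemma limn_einf_mono (u v : nat -> \bar R) : (forall k, u k <= v k) ->
  limn_einf u <= limn_einf v.
Proof.
move=> uv; rewrite !limn_einf_lim; apply: lee_lim; try exact: is_cvg_einfs.
near=> n; apply: le_ereal_inf_tmp => _ [k /= nk <-]; apply: (le_trans _ (uv k)).
by apply: ereal_inf_lbound; exists k.
Unshelve. all: by end_near. Qed.

Lemma measureU_null d (T : measurableType d) (mu : {measure set T -> \bar R}) (A B : set T) :
  measurable A -> measurable B -> mu A = 0 -> mu B = 0 -> mu (A `|` B) = 0.
Proof. by move=> mA mB A0 B0; rewrite measureU0. Qed.

(** The diagonal is removed because there both step functions pick the same point for every k. It is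
    null because its sections are single points. *)
Lemma unif_bad_null (D : set (measurableTypeR R)) : measurable D -> unif (~` D) = 0 ->
  (unif \x unif) (~` [set uv : measurableTypeR R * measurableTypeR R | [/\ D uv.1, D uv.2
    & uv.1 != uv.2]]) = 0
  /\ measurable [set uv : measurableTypeR R * measurableTypeR R | [/\ D uv.1, D uv.2 &
    uv.1 != uv.2]].
Proof.
move=> mD D0.
pose T := (measurableTypeR R * measurableTypeR R)%type.
pose Z : set T := [set uv | uv.1 = uv.2].
have mZ : measurable Z.
  have : measurable_fun [set: T] (fun uv => uv.1 == uv.2).
    by apply: measurable_fun_eqr; [exact: measurable_fst|exact: measurable_snd].
  move=> /(_ measurableT [set true]); rewrite setTI => /(_ _).
  rewrite (_ : _ @^-1` _ = Z); first exact.
  by apply/seteqP; split => uv /= /eqP.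
have Z0 : (unif \x unif) Z = 0.
  rewrite /= /product_measure1 /= integral0_eq // => u _.
  rewrite (_ : xsection Z u = [set u]).
    by apply: unif_null => //; exact: lebesgue_measure_set1.
  by apply/seteqP; split => v /=; rewrite /xsection /= in_setE /Z /=.
pose A : set T := (~` D) `*` setT; pose B : set T := setT `*` (~` D).
have mA : measurable A by apply: measurableX => //; exact: measurableC.
have mB : measurable B by apply: measurableX => //; exact: measurableC.
have E : ~` [set uv : T | [/\ D uv.1, D uv.2 & uv.1 != uv.2]] = A `|` B `|` Z.
  apply/seteqP; split => [[u v] /= H|[u v] /= [[[]|[]]|]]; rewrite /A /B /Z /=.
  - have [Du|?] := pselect (D u); last by left; left.
    have [Dv|?] := pselect (D v); last by left; right.
    by right; apply/eqP/negPn/negP => uv; apply: H.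
  - by move=> Du _ [].
  - by move=> _ Dv [].
  - by move=> -> [_ _]; rewrite eqxx.
split.
  pose P2 : {measure set T -> \bar R} := (unif \x unif).
  have A0 : (unif \x unif) A = 0.
    rewrite product_measure1E //; last exact: measurableC.
    exact: (etrans (congr1 (fun x => x * _) D0) (mul0e _)).
  have B0 : (unif \x unif) B = 0.
    rewrite product_measure1E //; last exact: measurableC.
    exact: (etrans (congr1 (fun x => _ * x) D0) (mule0 _)).
  have AB0 : P2 (A `|` B) = 0 by exact: (measureU_null mA mB A0 B0).
  by rewrite E; exact: (measureU_null (mu := P2) (measurableU _ _ mA mB) mZ AB0 Z0).
rewrite -[X in measurable X]setCK; apply: measurableC; rewrite E.
by apply: measurableU => //; exact: measurableU.
Qed.

(** The law mu is the image of the uniform law under the limit g of the step functions. Fatou's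
    lemma, applied to nonnegative kernels, bounds the integral of L - [logdist] by lim r = L - b. *)
Lemma energy_lower_bound (K : set (R * R)) (L b : R) (z0 : R * R)
    (s : nat -> seq (R * R)) (D : set (measurableTypeR R)) (r : nat -> R) :
  closed K -> K z0 -> (forall k z, z \in s k -> K z) -> (forall k, uniq (s k)) ->
  (forall k, (k < size (s k))%N) ->
  (forall z w, K z -> K w -> logdist (z, w) <= L%:E) ->
  measurable D -> unif (~` D) = 0 -> D `<=` `]0%R, 1%R[%classic ->
  (forall u, D u -> cvgn (fun k => (step_fun z0 (s k) u).1) /\
        cvgn (fun k => (step_fun z0 (s k) u).2)) ->
  r k @[k --> \oo] --> (L - b)%R ->
  (forall k, (size (s k))%:R^-1 ^+ 2 *
     \sum_(z <- s k) \sum_(w <- s k | w != z) (L - ln (edist z w)) <= r k)%R ->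
  exists mu : probability (R * R)%type R, mu (~` K) = 0 /\
    b%:E <= \int[mu \x mu]_zw logdist zw.
Proof.
move=> cK Kz0 sK us ss KL mD D0 D01 sc rc sr.
(* Setting the value [z0] off [D] makes the sequence converge everywhere, so that g maps every u
   into the closed set K. *)
pose G k u := if u \in D then step_fun z0 (s k) u else z0.
pose g u : R * R := (limn (fun k => (G k u).1), limn (fun k => (G k u).2)).
have KG k u : K (G k u).
  rewrite /G; case: ifP => // _; rewrite /step_fun.
  have [ks|ks] := ltnP (Num.truncn ((size (s k))%:R * u)%R) (size (s k)).
    by apply: (sK k); exact: mem_nth.
  by rewrite nth_default.
have Gc u : cvgn (fun k => (G k u).1) /\ cvgn (fun k => (G k u).2).
  rewrite /G; have [uD|uD] := boolP (u \in D); first exact/sc/set_mem.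
  by split; apply: is_cvg_cst.
have Kg u : K (g u).
  have [c1 c2] := Gc u.
  have c12 : (G k u) @[k --> \oo] --> g u.
    rewrite (_ : (fun k => G k u) = (fun k => ((G k u).1, (G k u).2))); last first.
      by apply/funext => k; case: (G k u).
    exact: cvg_pair c1 c2.
  by apply: (closed_cvg _ cK _ _ c12); exists 0%N => // k _; exact: KG.
have mGk d (U : measurableType d) (f : R * R -> U) k :
    measurable_fun [set: measurableTypeR R] (fun u => f (G k u)).
  rewrite /G (_ : (fun u => _) = fun u => if u \in D then f (step_fun z0 (s k) u) else f
    z0); last first.
    by apply/funext => u; case: ifP.
  apply: measurable_fun_ifT => //; last exact: measurable_step_fun.
  by apply: measurable_fun_bool; rewrite setTI (_ : _ @^-1` _ = D) //; apply/seteqP;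
    split => [u /set_mem|u /mem_set].
have mg : measurable_fun [set: measurableTypeR R] g.
  apply: measurable_fun_pair.
    apply: (@measurable_fun_cvg _ _ _ setT (fun k u => (G k u).1)) => [k|u _]; first exact: mGk.
    by have [] := Gc u.
  apply: (@measurable_fun_cvg _ _ _ setT (fun k u => (G k u).2)) => [k|u _]; first exact: mGk.
  by have [] := Gc u.
pose g' : {mfun measurableTypeR R >-> (R * R)%type} := mfun_Sub (mem_set mg).
pose T := (measurableTypeR R * measurableTypeR R)%type.
have mlg : measurable_fun [set: T] (fun uv => logdist (g uv.1, g uv.2)).
  apply: (measurableT_comp measurable_logdist (g := fun uv : T => (g uv.1, g uv.2))).
  apply: measurable_fun_pair.
    exact: (measurableT_comp mg measurable_fst).
  exact: (measurableT_comp mg measurable_snd).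
pose F (uv : T) := L%:E - logdist (g uv.1, g uv.2).
have F0 uv : 0 <= F uv by rewrite /F subre_ge0 //; exact: KL.
have mF : measurable_fun [set: T] F by apply: emeasurable_funB.
pose h k (uv : T) := (pos_logdist L (step_fun z0 (s k) uv.1) (step_fun z0 (s k) uv.2))%:E.
have mh k : measurable_fun [set: T] (h k).
  apply/measurable_EFinP.
  apply: (measurableT_comp (measurable_pos_logdist L) (g := fun uv : T => (step_fun z0 (s
    k) uv.1, step_fun z0 (s k) uv.2))).
  apply: measurable_fun_pair.
    exact: (measurableT_comp (@measurable_step_fun _ _ _ id z0 (s k)) measurable_fst).
  exact: (measurableT_comp (@measurable_step_fun _ _ _ id z0 (s k)) measurable_snd).
have s0 k : (0 < size (s k))%N by rewrite (leq_ltn_trans _ (ss k)).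
(* On points of K, [pos_logdist] vanishes on the diagonal and is L - ln of the distance off it, so
   the double sum is the off-diagonal one bounded by [r k]. *)
have hr k : \int[unif \x unif]_uv h k uv <= (r k)%:E.
  rewrite integral2_step_fun //; last 2 first.
  - exact: pos_logdist_ge0.
  - exact: measurable_pos_logdist.
  rewrite lee_fin (le_trans _ (sr k)) // ler_wpM2l ?sqr_ge0 //.
  rewrite big_seq [leRHS]big_seq; apply: ler_sum => z zs.
  rewrite [leRHS]big_mkcond big_seq [leRHS]big_seq; apply: ler_sum => w ws.
  rewrite /pos_logdist edist_eq0 eq_sym; case: eqVneq => //= wz.
  have := KL z w (sK _ _ zs) (sK _ _ ws).
  rewrite logdistE edist_eq0 eq_sym (negbTE wz) lee_fin => Lzw.
  by rewrite (@max_r _ _ 0%R) // subr_ge0.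
pose good := [set uv : T | [/\ D uv.1, D uv.2 & uv.1 != uv.2]].
have [bad0 mgood] := unif_bad_null mD D0.
have Fh uv : good uv -> F uv <= limn_einf (fun k => h k uv).
  move=> [Du Dv uv1]; apply: le_limn_einf => a; rewrite /F => aF.
  have {}aF : logdist (g uv.1, g uv.2) < (L - a)%:E.
    by move: aF; case: logdist => [x| |] //=; rewrite ?ltNyr // -EFinB !lte_fin; lra.
  have [c1 c2] := Gc uv.1; have [c3 c4] := Gc uv.2.
  have [N1 HN] := @logdist_usc R (fun k => G k uv.1) (fun k => G k uv.2) (g uv.1) (g
    uv.2) _ c1 c2 c3 c4 aF.
  (* Once size * |u - v| > 1 the two indices differ, and so do the points since the list has no
     repetition; the diagonal default 0 of [pos_logdist] is then avoided. *)
  have [N2 HN2] : exists N2, forall k, (N2 <= k)%N -> (1 < (size (s k))%:R * `|uv.1 - uv.2|)%R.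
    have d0 : (0 < `|uv.1 - uv.2|)%R by rewrite normr_gt0 subr_eq0.
    have [n _ /(_ n (leqnn n)) /= Hn] := near_infty_natSinv_lt (PosNum d0).
    exists n => k nk; rewrite -ltr_pdivrMl ?ltr0n // mulr1 (le_lt_trans _ Hn) //.
    by rewrite lef_pV2 ?posrE ?ltr0n // ler_nat (leq_ltn_trans nk).
  exists (maxn N1 N2) => k; rewrite geq_max => /andP[/HN Hk /HN2 Nk].
  move: Hk; rewrite /G !mem_set // /h lee_fin /pos_logdist logdist_lt => Hk.
  have sz (u : R) : D u -> (Num.truncn ((size (s k))%:R * u)%R < size (s k))%N.
    move=> /D01; rewrite /= in_itv /= => /andP[u0 u1].
    by rewrite truncn_lt_nat ?mulr_ge0 ?(ltW u0) // -[ltRHS]mulr1 ltr_pM2l // ltr0n.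
  have pos0 (u : R) : D u -> (0 <= (size (s k))%:R * u)%R.
    by move=> /D01; rewrite /= in_itv /= => /andP[u0 u1]; rewrite mulr_ge0 // ltW.
  have nd : (edist (step_fun z0 (s k) uv.1) (step_fun z0 (s k) uv.2) == 0%R) = false.
    rewrite edist_eq0 nth_uniq ?sz //; apply/negbTE/eqP => ee.
    have /truncn_itv/andP[] := pos0 _ Du; have /truncn_itv/andP[] := pos0 _ Dv.
    rewrite ee -natr1 => x1 x2 x3 x4; move: Nk.
    rewrite -[((size (s k))%:R)%R]ger0_norm // -normrM mulrBr ltNge => /negP; apply.
    by rewrite ler_norml; apply/andP; split; lra.
  rewrite nd le_max; apply/orP; right; rewrite lerBrDr addrC -lerBrDr.
  rewrite -[leRHS]expRK ler_ln ?posrE ?expR_gt0 //; first exact: ltW.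
  by rewrite lt_def nd edist_ge0.
have FT : \int[unif \x unif]_uv F uv <= (L - b)%:E.
  rewrite (@ge0_negligible_integral _ _ _ (unif \x unif) setT (~` good)) //; last first.
    exact: measurableC.
  rewrite setDE setCK setTI.
  have ml : measurable_fun [set: T] (fun uv => limn_einf (fun k => h k uv)).
    rewrite /limn_einf; apply: measurableT_comp => //.
    by apply: measurable_fun_limn_esup => k; exact: measurableT_comp.
  have l0 uv : 0 <= limn_einf (fun k => h k uv).
    by apply: le_limn_einf => a a0; exists 0%N => k _; rewrite (le_trans (ltW a0)) //
      lee_fin pos_logdist_ge0.
  apply: (@le_trans _ _ (\int[unif \x unif]_(uv in good) limn_einf (fun k => h k uv))).
    by apply: ge0_le_integral => //; try exact: measurable_funTS; move=> *; exact: Fh.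
  apply: (@le_trans _ _ (\int[unif \x unif]_uv limn_einf (fun k => h k uv))).
    by apply: ge0_subset_integral.
  apply: (le_trans (fatou _ _ _ _)) => //.
    by move=> k uv _; rewrite lee_fin pos_logdist_ge0.
  have <- : limn_einf (fun k => (r k)%:E) = (L - b)%:E.
    have rE : (r k)%:E @[k --> \oo] --> (L - b)%:E.
      by apply: cvg_EFin => //; exact: nearW.
    exact: (cvg_limn_einf_sup rE).1.
  exact: limn_einf_mono.
(* Finiteness of this integral licenses the subtraction from L below. *)
have iF : (unif \x unif).-integrable [set: T] F.
  apply/integrableP; split => //.
  under eq_integral do rewrite gee0_abs //.
  exact: le_lt_trans FT (ltry _).
have PT : (unif \x unif) [set: T] = 1.
  rewrite -setXTT product_measure1E //.
  exact: (etrans (congr2 mule (probability_setT unif) (probability_setT unif)) (mule1 _)).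
have cstL (x : R) : \int[unif \x unif]_(_ in [set: T]) x%:E = x%:E.
  by rewrite integral_cst // -[X in _ * X]/((unif \x unif) [set: T]) PT mule1.
have iL : (unif \x unif).-integrable [set: T] (cst L%:E).
  apply/integrableP; split => //=.
  by rewrite cstL ltry.
(* Valid where [logdist] is -oo as well; the value +oo is excluded by the upper bound L. *)
have lE : (fun uv : T => logdist (g uv.1, g uv.2)) = cst L%:E \- F.
  apply/funext => uv; rewrite /F /=.
  have := KL _ _ (Kg uv.1) (Kg uv.2); case: logdist => [x|//|] _ //.
  by rewrite oppeB // addeA subee // add0e.
exists (distribution unif g'); split.
  have K0 : g @^-1` (~` K) = set0 by rewrite -subset0 => u; apply; exact: Kg.
  exact: (etrans (congr1 unif K0) (measure0 unif)).
rewrite integral_distribution_prod.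
- rewrite (eq_integral (cst L%:E \- F)) => [|uv _]; last exact: (congr1 (@^~ uv) lE).
  rewrite integralB //.
  rewrite cstL leeBrDr; last first.
    by rewrite ge0_fin_numE ?(le_lt_trans FT (ltry _)) //; exact: integral_ge0.
  apply: (le_trans (leeD2l _ FT)).
  by rewrite -EFinD lee_fin addrC subrK.
- exact: measurable_logdist.
- rewrite [X in _.-integrable _ X](_ : _ = cst L%:E \- F) //; exact: integrableB.
Qed.

End EnergyBound.

(** * Finiteness of the capacity of a bounded set *)

Section CapacityFinite.
Context {R : realType}.
Local Open Scope ereal_scope.

(** The plane carries the product sigma-algebra, so an open set is written as a countable union of
    rational boxes. *)
Lemma open_measurable_plane (U : set (R * R)) : open U -> measurable U.
Proof.
move=> oU.
pose B (q : (rat * rat) * (rat * rat)) : set (R * R) :=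
  [set` `](ratr q.1.1), (ratr q.1.2)[%R] `*` [set` `](ratr q.2.1), (ratr q.2.2)[%R].
rewrite (_ : U = \bigcup_(q in [set q | B q `<=` U]) B q).
  rewrite bigcup_mkcond; apply: countable_bigcupT_measurable.
    exact: countableP.
  move=> q; case: ifP => // _; apply: measurableX; exact: measurable_itv.
apply/seteqP; split => [z Uz|z [q /= qU]]; last exact: qU.
have /nbhs_ballP[e /= e0 eU] := open_nbhs_nbhs (conj oU Uz).
have near (x : R) : exists q1 q2 : rat,
    [/\ (ratr q1 < x)%R, (x < ratr q2)%R & forall y, (ratr q1 < y < ratr q2)%R -> ball x e y].
  have xe : (x - e < x)%R by rewrite ltrBlDr ltrDl.
  have ex : (x < x + e)%R by rewrite ltrDl.
  have [q1 /itvP h1] := rat_in_itvoo xe; have [q2 /itvP h2] := rat_in_itvoo ex.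
  exists q1, q2; split; rewrite ?h1 ?h2 // => y /andP[y1 y2].
  rewrite -ball_normE /= distrC ltr_distl (lt_trans _ y1) ?h1 //=.
  by rewrite (lt_trans y2) // h2.
have [p1 [p2 [p1z p2z pB]]] := near z.1; have [q1 [q2 [q1z q2z qB]]] := near z.2.
exists ((p1, p2), (q1, q2)) => /=.
  by move=> w [] /=; rewrite !in_itv /= => /pB wB1 /qB wB2; apply: eU.
by split; rewrite /= in_itv /= ?p1z ?p2z ?q1z ?q2z.
Qed.

(** Dropping the negative part of the kernel only increases the integral, so integrability is not at
    issue. Up to a null set the positive part is integrated over pairs of points of K, where it is
    at most L. *)
Lemma log_energy_sup_le (K : set (complex R)) (L : R) : measurable (c2p @` K) ->
  (0 <= L)%R ->
  (forall z w, (c2p @` K) z -> (c2p @` K) w -> logdist (z, w) <= L%:E) ->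
  log_energy_sup K <= L%:E.
Proof.
move=> mK L0 KL; apply: ge_ereal_sup => _ [mu /= muK <-].
set Q := c2p @` K in mK KL muK.
pose T := ((R * R) * (R * R))%type.
pose P2 : {measure set T -> \bar R} := (mu \x mu)%E.
have mQC : measurable (~` Q) by exact: measurableC.
pose A : set T := (~` Q) `*` setT; pose B : set T := setT `*` (~` Q).
have mA : measurable A by exact: measurableX.
have mB : measurable B by exact: measurableX.
have A0 : (mu \x mu) A = 0.
  rewrite product_measure1E //.
  exact: (etrans (congr1 (fun x => x * _) muK) (mul0e _)).
have B0 : (mu \x mu) B = 0.
  rewrite product_measure1E //.
  exact: (etrans (congr1 (fun x => _ * x) muK) (mule0 _)).
have N0 : P2 (A `|` B) = 0 by exact: (measureU_null mA mB A0 B0).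
have mN : measurable (A `|` B) by exact: measurableU.
have PT : P2 setT = 1.
  rewrite /P2 -setXTT [LHS](product_measure1E mu mu) //.
  exact: (etrans (congr2 mule (probability_setT mu) (probability_setT mu)) (mule1 _)).
rewrite -[X in X <= _]/(\int[P2]_zw logdist zw) integralE.
apply: (@le_trans _ _ (\int[P2]_zw logdist^\+ zw)).
  by rewrite -[leRHS]adde0 leeD2l // oppe_le0 integral_ge0.
rewrite (@ge0_negligible_integral _ _ _ P2 setT (A `|` B)) //; last first.
  by apply: measurable_funepos; exact: measurable_logdist.
apply: (@le_trans _ _ (\int[P2]_(zw in setT `\` (A `|` B)) L%:E)).
  apply: ge0_le_integral => //.
  - exact: measurableD.
  - by apply: measurable_funTS; apply: measurable_funepos; exact: measurable_logdist.
  - by move=> [z w] [_ zw]; rewrite funeposE ge_max lee_fin L0 andbT; apply: KL;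
    apply: contrapT => H; apply: zw; [left|right].
rewrite integral_cst; last exact: measurableD.
rewrite -[leRHS]mule1 lee_wpmul2l ?lee_fin // -PT.
by apply: le_measure => //; rewrite inE //; exact: measurableD.
Qed.

End CapacityFinite.

(** * Chebyshev polynomials and capacity *)

Section Chebyshev.
Context {R : realType}.
Local Notation C := (complex R).

Lemma c2p_inj : injective (@c2p R).
Proof. by move=> [a b] [c d] [-> ->]. Qed.

Lemma cabs_edist (x y : C) : cabs (x - y) = edist (c2p x) (c2p y).
Proof. by case: x y => a b [c d]. Qed.

(** Each squared coordinate difference is at most 4 M^2, and 8 M^2 <= (4 M)^2. *)
Lemma edist_le (M : R) z w : `|z.1| <= M -> `|z.2| <= M -> `|w.1| <= M -> `|w.2| <= M ->
  edist z w <= 4 * M.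
Proof.
rewrite !ler_norml => /andP[? ?] /andP[? ?] /andP[? ?] /andP[? ?].
have M0 : 0 <= M by lra.
rewrite -[leRHS]ger0_norm; last by rewrite mulr_ge0.
rewrite -sqrtr_sqr ler_wsqrtr // exprMn.
have sq (a b : R) : - M <= a -> a <= M -> - M <= b -> b <= M -> (a - b) ^+ 2 <= 4 * M ^+ 2.
  by move=> ? ? ? ?; nra.
have h1 := sq z.1 w.1; have h2 := sq z.2 w.2.
by apply: (le_trans (lerD (h1 _ _ _ _) (h2 _ _ _ _))) => //; nra.
Qed.

(** The [+ 1] keeps the argument of [ln] positive when M = 0 and makes the bound nonnegative. *)
Lemma logdist_le (M : R) (z w : R * R) : 0 <= M -> edist z w <= M ->
  (logdist (z, w) <= (ln (M + 1))%:E)%E.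
Proof.
move=> M0 dM; rewrite ltW // logdist_lt lnK ?posrE; first by rewrite (le_lt_trans dM) // ltrDl.
by rewrite ltr_wpDl.
Qed.

Lemma sum_offdiag_const (T : eqType) (s : seq T) (L : R) (f : T -> T -> R) : uniq s ->
  \sum_(z <- s) \sum_(w <- s | w != z) (L - f z w) =
  (size s)%:R * (size s).-1%:R * L - \sum_(z <- s) \sum_(w <- s | w != z) f z w.
Proof.
move=> us; under eq_bigr do rewrite sumrB; rewrite sumrB; congr (_ - _).
transitivity (\sum_(z <- s) (size s).-1%:R * L).
  rewrite !big_seq; apply: eq_bigr => z zs.
  rewrite big_const_seq iter_addr_0 -[L *+ _]mulr_natl; congr (_%:R * _).
  by rewrite -(count_predC (pred1 z) s) count_uniq_mem // zs.
by rewrite big_const_seq count_predT iter_addr_0 -[_ *+ size s]mulr_natl mulrA.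
Qed.

(** The contradiction is a law on X of energy at least ln c, whereas the supremum i is below ln
    c. *)
Lemma chebyshev_le_cap (X : set C) (c i : R) : compact (c2p @` X) -> X !=set0 ->
  log_energy_sup X = i%:E -> expR i < c ->
  exists t0, forall t, (t0 <= t)%N -> exists p : {poly C},
    [/\ p \is monic, size p = t.+1 & forall z, X z -> cabs p.[z] <= c ^+ t].
Proof.
move=> cX [x0 Xx0] Xi ic; apply: contrapT => H.
have c0 : 0 < c := lt_trans (expR_gt0 i) ic.
(* Negating the conclusion gives, beyond every T, a degree at which each monic polynomial is too
   large somewhere on X. *)
have /choice[tau tauP] : forall T, exists t, (T <= t)%N /\
    forall p : {poly C}, p \is monic -> size p = t.+1 ->
     exists2 z, X z & c ^+ t < cabs p.[z].
  move=> T; apply: contrapT => HT; apply: H; exists T => t Tt.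
  apply: contrapT => Ht; apply: HT; exists t; split => // p pm sp.
  apply: contrapT => Hz; apply: Ht; exists p; split => // z Xz.
  by rewrite leNgt; apply/negP => zc; apply: Hz; exists z.
(* Compactness bounds the set by every number above [M0], hence the choice M0 + 1; the maximum with
   0 makes M nonnegative. *)
have [M0 [_ MX]] := compact_bounded cX.
pose M := Num.max 0 (M0 + 1).
have XM z : (c2p @` X) z -> `|z.1| <= M /\ `|z.2| <= M.
  move=> Xz; have := MX (M0 + 1); rewrite ltrDl ltr01 => /(_ isT) /(_ z Xz) Mz.
  have : Num.max `|z.1| `|z.2| <= M0 + 1 := Mz.
  rewrite ge_max => /andP[z1 z2]; rewrite /M.
  by split; rewrite le_max ?z1 ?z2 orbT.
have M_ge0 : 0 <= M by rewrite le_max lexx.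
have KL z w : (c2p @` X) z -> (c2p @` X) w -> edist z w <= 4 * M.
  by move=> /XM[? ?] /XM[? ?]; apply: edist_le.
have M4 : 0 <= 4 * M by rewrite mulr_ge0.
pose L := ln (4 * M + 1).
have /choice[s sP] : forall T, exists s : seq C, [/\ uniq s, size s = (tau T).+1, forall
  a, a \in s -> X a &
    (tau T).+1%:R * ((tau T)%:R * ln c - ln 2) <=
      \sum_(x <- s) \sum_(y <- s | y != x) ln (cabs (x - y))].
  move=> T; apply: (exists_fekete_seq (L := 4 * M) c0) => [x y Xx Xy|].
    by rewrite cabs_edist KL.
  by have [] := tauP T.
pose S T := map (@c2p R) (s T).
have SX T z : z \in S T -> (c2p @` X) z.
  by move=> /mapP[a aS ->]; have [_ _ sX _] := sP T; exists a => //; exact: sX.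
have SS T : size (S T) = (tau T).+1 by rewrite size_map; have [] := sP T.
have uS T : uniq (S T) by rewrite map_inj_uniq; [have [] := sP T|exact: c2p_inj].
have SE T : (tau T).+1%:R * ((tau T)%:R * ln c - ln 2) <=
     \sum_(x <- S T) \sum_(y <- S T | y != x) ln (edist x y).
  have [_ _ _ /le_trans] := sP T; apply; rewrite big_map; apply: ler_sum => x _.
  rewrite big_map [leRHS](eq_bigl (fun y => y != x)); last by move=> y /=; rewrite
    (inj_eq c2p_inj).
  by apply: ler_sum => y _; rewrite cabs_edist.
have [||s' [sigma [E [ksigma ps cE sc]]]] := @step_fun_cvg R (c2p x0) M S.
- by move=> k z /SX/XM.
- by move=> k; rewrite SS ltnS; have [] := tauP k.
have s's k : size (s' k) = (tau (sigma k)).+1 by rewrite (perm_size (ps k)) SS.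
have us' k : uniq (s' k) by rewrite (perm_uniq (ps k)).
have ks' k : (k < size (s' k))%N.
  by rewrite s's ltnS (leq_trans (ksigma k)) //; have [] := tauP (sigma k).
pose D : set (measurableTypeR R) := [set` `]0%R, 1%R[] `\` E.
have mE : measurable (E : set (measurableTypeR R)).
  by apply: countable_measurable => // x; exact: measurable_set1.
have mD : measurable D by apply: measurableD => //; exact: measurable_itv.
have D0 : unif (~` D) = 0%E.
  rewrite /D setDE setCI setCK; apply: measureU_null => //.
  - by apply: measurableC; exact: measurable_itv.
  - exact: unif_setC01.
  - by apply: unif_null => //; exact: countable_lebesgue_measure0.
(* With N points this is (N (N-1) L - N ((N-1) ln c - ln 2)) / N^2 simplified; the ln 2 is the
   factor 2 lost in [exists_fekete]. *)
pose r k := (L - ln c) + (ln 2 - (L - ln c)) * (size (s' k))%:R^-1.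
have rc : r k @[k --> \oo] --> L - ln c.
  rewrite -[X in _ --> X]addr0; apply: cvgD; first exact: cvg_cst.
  rewrite -[X in _ --> X](mulr0 (ln 2 - (L - ln c))); apply: cvgM; first exact: cvg_cst.
  apply/cvgrPdist_lt => e e0; near=> k.
  rewrite sub0r normrN ger0_norm ?invr_ge0 //.
  apply: (@le_lt_trans _ _ k.+1%:R^-1).
    by rewrite lef_pV2 ?posrE ?ltr0n ?(leq_ltn_trans _ (ks' k)) // ler_nat.
  by near: k; exact: near_infty_natSinv_lt (PosNum e0).
have sr k : (size (s' k))%:R^-1 ^+ 2 *
     \sum_(z <- s' k) \sum_(w <- s' k | w != z) (L - ln (edist z w)) <= r k.
  rewrite sum_offdiag_const //.
  have -> : \sum_(z <- s' k) \sum_(w <- s' k | w != z) ln (edist z w) =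
     \sum_(z <- S (sigma k)) \sum_(w <- S (sigma k) | w != z) ln (edist z w).
    by rewrite (perm_big _ (ps k)) /=; apply: eq_bigr => z _; rewrite (perm_big _ (ps k)).
  rewrite /r s's /=; have := SE (sigma k); move: (tau (sigma k)) => t.
  set Z := \sum_(_ <- _) _ => tZ.
  have t0 : 0 < t.+1%:R :> R by rewrite ltr0n.
  apply: (@le_trans _ _ (t.+1%:R^-1 ^+ 2 * (t.+1%:R * t%:R * L - t.+1%:R * (t%:R * ln c -
    ln 2)))).
    by rewrite ler_wpM2l ?sqr_ge0 // lerD2l lerN2.
  by rewrite -natr1 in t0 *; rewrite le_eqVlt; apply/orP; left; apply/eqP; field; rewrite
    gt_eqF.
have [mu [muX muE]] : exists mu : probability (R * R)%type R, mu (~` (c2p @` X)) = 0%E /\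
    ((ln c)%:E <= \int[mu \x mu]_zw logdist zw)%E.
  apply: (@energy_lower_bound R (c2p @` X) L (ln c) (c2p x0) s' D r) => //.
  - by apply: compact_closed => //; exact: norm_hausdorff.
  - by move=> k z; rewrite (perm_mem (ps k)); exact: SX.
  - by move=> z w Xz Xw; apply: logdist_le => //; exact: KL.
  - by move=> u [].
  - by move=> u [/= u01 Eu]; apply: sc => //; move: u01; rewrite in_itv.
have : ((ln c)%:E <= i%:E)%E.
  rewrite -Xi (le_trans muE) //; apply: ereal_sup_ubound; exists mu => //.
rewrite lee_fin => ci; move: ic; rewrite ltNge => /negP; apply.
by rewrite -[leLHS]lnK ?posrE // ler_expR.
Unshelve. all: by end_near. Qed.

End Chebyshev.

(** * From eventual bounds to a rate tending to zero *)

Section Rate.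
Context {R : realType}.

(** Here [P e t] reads: e is admissible at t. The rate is the infimum of the admissible values plus
    1/(t+1), because the infimum need not be attained. *)
Lemma eps_of_eventually (P : R -> nat -> Prop) :
  (forall e e' t, 0 <= e -> e <= e' -> P e t -> P e' t) ->
  (forall t, exists2 e, 0 <= e & P e t) ->
  (forall e, 0 < e -> exists t0, forall t, (t0 <= t)%N -> P e t) ->
  exists eps : nat -> R, eps @ \oo --> 0 /\ forall t, P (eps t) t.
Proof.
move=> Pmono Pex Pev; pose S t := [set e | 0 <= e /\ P e t].
have Sinf t : has_inf (S t).
  split; first by have [e e0 eP] := Pex t; exists e.
  by exists 0 => e [].
have S0 t : 0 <= inf (S t).
  by apply: lb_le_inf; [have [e e0 eP] := Pex t; exists e|move=> e []].
exists (fun t => inf (S t) + t.+1%:R^-1); split.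
  apply/cvgrPdist_lt => e e0.
  have e2 : 0 < e / 2 by rewrite divr_gt0.
  have [t0 Pt0] := Pev _ e2; near=> t.
  have tt0 : (t0 <= t)%N by near: t; exists t0.
  rewrite sub0r normrN ger0_norm ?addr_ge0 ?invr_ge0 // (splitr e) ler_ltD //.
    apply: ge_inf; first by have [_] := Sinf t.
    by split; [exact: ltW|exact: Pt0].
  by near: t; exact: near_infty_natSinv_lt (PosNum e2).
move=> t; have t1 : 0 < t.+1%:R^-1 :> R by rewrite invr_gt0.
by have [e [e0 Pe] /ltW elt] := inf_adherent t1 (Sinf t); exact: Pmono Pe.
Unshelve. all: by end_near. Qed.

End Rate.

(** * Assembly of the bound *)

Theorem theorem1 (R : realType) (X : set (complex R))
    (hX : compact (c2p @` X)) (hcap : (0 < cap X)%E) :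
  exists eps : nat -> R, eps @ \oo --> 0 /\
  forall (n k : nat) (A V D : 'M[complex R]_n) (B : 'M[complex R]_(n, k)),
    (0 < n)%N -> (0 < k)%N ->
    V \in unitmx -> is_diag_mx D -> V *m A *m invmx V = D ->
    (forall a, eigenvalue A a -> X a) ->
    let tmin := (n.-1 %/ k)%N in
    lambda_min (gramian A B tmin)
      <= cond V ^+ 2 * frob B ^+ 2 * ((1 + eps tmin) * fine (cap X) ^+ 2) ^+ tmin.
Proof.
have [M [M0 XM]] : exists M : R, 0 <= M /\ forall z, X z -> `|(c2p z).1| <= M /\ `|(c2p
  z).2| <= M.
  have [M0 [_ MX]] := compact_bounded hX.
  exists (Num.max 0 (M0 + 1)); split; first by rewrite le_max lexx.
  move=> z Xz; have := MX (M0 + 1); rewrite ltrDl ltr01 => /(_ isT) /(_ (c2p z)) /(_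
    (imageP _ Xz)) Mz.
  have : Num.max `|(c2p z).1| `|(c2p z).2| <= M0 + 1 := Mz.
  rewrite ge_max => /andP[z1 z2].
  by split; rewrite le_max ?z1 ?z2 orbT.
have M4 : 0 <= 4 * M by rewrite mulr_ge0.
have mK : measurable (c2p @` X).
  rewrite -[X in measurable X]setCK; apply: measurableC; apply: open_measurable_plane.
  by apply: closed_openC; apply: compact_closed => //; exact: norm_hausdorff.
have Ile : (log_energy_sup X <= (ln (4 * M + 1))%:E)%E.
  apply: log_energy_sup_le => //; first by rewrite ln_ge0 // lerDr.
  move=> _ _ [z Xz <-] [w Xw <-]; apply: logdist_le => //.
  by have [? ?] := XM _ Xz; have [? ?] := XM _ Xw; apply: edist_le.
(* [Ile] excludes +oo, and -oo would make the capacity 0; hence [fine] loses nothing. *)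
have [i Xi] : exists i : R, log_energy_sup X = i%:E.
  move: hcap Ile; rewrite /cap; case: log_energy_sup => [i _ _| |]; first by exists i.
    by rewrite leye_eq.
  by rewrite /= ltxx.
have capE : fine (cap X) = expR i by rewrite /cap Xi.
have X0 : X !=set0.
  (* No probability law is carried by the empty set, so the supremum would be -oo. *)
  apply/set0P/eqP => X0; move: Xi; rewrite /log_energy_sup X0 image_set0 setC0.
  rewrite (_ : [set mu : probability _ R | _] = set0) ?image_set0 ?ereal_sup0 //.
  rewrite -subset0 => mu /= H.
  by have := probability_setT mu; rewrite [LHS]H => -[/esym/eqP]; rewrite oner_eq0.
rewrite capE; set kappa := expR i.
have k0 : 0 < kappa by exact: expR_gt0.
have kge0 := ltW k0.
(* Admissibility involves only X and t, which makes the resulting rate uniform in n, k, A, V and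
   B. *)
pose P e t := exists p : {poly complex R}, [/\ p \is monic, size p = t.+1 &
  forall z, X z -> cabs p.[z] ^+ 2 <= ((1 + e) * kappa ^+ 2) ^+ t].
have [||| eps [eps0 Peps]] := @eps_of_eventually R P.
- move=> e e' t e0 ee' [p [pm sp pX]]; exists p; split => // z /pX /le_trans; apply.
  have e'0 : 0 <= e' := le_trans e0 ee'.
  apply: lerXn2r; rewrite ?nnegrE ?mulr_ge0 ?addr_ge0 ?sqr_ge0 //.
  by rewrite ler_wpM2r ?sqr_ge0 // lerD2l.
(* With this e, (1 + e) kappa^2 = kappa^2 + (4 M)^2 dominates |z|^2 on X, so the monomial of degree
   t serves. *)
- move=> t; exists ((4 * M) ^+ 2 / kappa ^+ 2).
    by rewrite divr_ge0 ?sqr_ge0.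
  exists 'X^t; split; rewrite ?monicXn ?size_polyXn // => z Xz.
  rewrite hornerXn; have -> : cabs (z ^+ t) = cabs z ^+ t.
    elim: t => [|t IH]; last by rewrite !exprS cabsM IH.
    by rewrite !expr0 cabsE complex.ComplexField.Normc.normc1.
  rewrite exprAC mulrDl mul1r mulfVK ?expf_neq0 ?gt_eqF //.
  apply: lerXn2r; rewrite ?nnegrE ?addr_ge0 ?sqr_ge0 // ler_wpDl ?sqr_ge0 //.
  apply: lerXn2r; rewrite ?nnegrE ?cabs_ge0 //.
  have [? ?] := XM _ Xz.
  by rewrite -[z]subr0 cabs_edist; apply: edist_le; rewrite //= normr0.
(* Chosen so that c^2 = (1 + e) kappa^2 and c > kappa. *)
- move=> e e0; pose c := Num.sqrt (1 + e) * kappa.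
  have e1 : 0 <= 1 + e by rewrite addr_ge0 // ltW.
  have ck : kappa < c by rewrite /c ltr_pMl // -[ltLHS]sqrtr1 ltr_sqrt ?ltrDl // ltr_wpDl.
  have [t0 H] := chebyshev_le_cap hX X0 Xi ck; exists t0 => t /H[p [pm sp pX]].
  exists p; split => // z /pX zc.
  have -> : (1 + e) * kappa ^+ 2 = c ^+ 2 by rewrite exprMn sqr_sqrtr.
  rewrite exprAC; apply: lerXn2r; rewrite ?nnegrE ?cabs_ge0 //.
  by rewrite exprn_ge0 // ltW // (lt_trans k0).
exists eps; split => // n k A V D B n0 k0' uV Dd VAV evX.
cbv zeta; set tmin := (n.-1 %/ k)%N.
have [p [pm sp pX]] := Peps tmin.
set q := ((1 + eps tmin) * kappa ^+ 2) ^+ tmin in pX *.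
have [x0 Xx0] := X0.
(* The sign of [eps] has not been recorded; q is nonnegative because it dominates a square at a
   point of X. *)
have q0 : 0 <= q by rewrite (le_trans _ (pX _ Xx0)) ?sqr_ge0.
rewrite -[q]sqr_sqrtr //.
apply: (@lambda_min_gramian_le R n k A V D B p (Num.sqrt q) n0 k0' uV Dd VAV pm sp
  (sqrtr_ge0 q)).
move=> a /evX /pX apX.
by rewrite -[leLHS]ger0_norm ?cabs_ge0 // -sqrtr_sqr ler_wsqrtr.
Qed.
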